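(* Let $\mathcal{H}$ be a complex separable Hilbert space, let $H_0,H_1$ be densely defined selfadjoint operators on $\mathcal{H}$ such that $(1-P_j^{\mathrm{ac}})H_j$ is bounded for $j=0,1$, and let $f\in C(\mathbb{R})$ be a continuous real-valued function such that $H_0$ and $H_1$ are $f$-equivalent. Denote $W_\pm=W_\pm(H_1,H_0)$. Let $B$ be a bounded operator on $\mathcal{H}$ and let $A$ be a selfadjoint (unbounded) operator on $\mathcal{H}$ such that $\|Af(H_j)^{-1}\|<\infty$ for $j=0,1$. Then $B^*AB$ is bounded above (respectively below) if and only if $B^*W_\pm^*AW_\pm B$ is bounded above (respectively below).
   Context: $P_j^{\mathrm{ac}}$ is the orthogonal projection onto the absolutely continuous subspace of $H_j$. The wave operators are $W_\pm(H_1,H_0)=\operatorname{s-lim}_{t\to\pm\infty}e^{itH_1}e^{-itH_0}P_0^{\mathrm{ac}}$, if they exist; they are complete if their ranges equal $P_1^{\mathrm{ac}}\mathcal{H}$. The pair $(H_1,H_0)$ is $f$-bounded if $W_\pm(H_1,H_0)$ exist and $(W_\pm(H_1,H_0)-P_1^{\mathrm{ac}}P_0^{\mathrm{ac}})f(H_0)$ is bounded (extends from $\operatorname{dom}f(H_0)$ to a bounded operator). Operators $H_0,H_1$ with $(1-P_j^{\mathrm{ac}})H_j$ bounded ($j=0,1$) are called $f$-equivalent if $(H_1,H_0)$ is $f$-bounded, $W_\pm(H_1,H_0)$ are complete, and $f(H_0)-f(H_1)$ is bounded (i.e. $\operatorname{dom}f(H_0)=\operatorname{dom}f(H_1)$ and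 the difference extends to a bounded operator). This is an equivalence relation. Conventions: the condition $\|Af(H_j)^{-1}\|<\infty$ means that $f(H_j)$ is injective, $A$ is defined on $\operatorname{dom}f(H_j)$, and $Af(H_j)^{-1}$ (defined on the range of $f(H_j)$) is bounded. For a bounded operator $C$, ''$C^*AC$ is bounded above (below)'' means that the quadratic form $\psi\mapsto\langle C\psi,AC\psi\rangle$ on $\{\psi\in\mathcal{H}: C\psi\in\operatorname{dom}A\}$ is bounded above (below) by a constant multiple of $\|\psi\|^2$. The statement holds for each of the signs $+$ and $-$ separately. *)

(* Defs.v *)
From HB Require Import structures.
From mathcomp Require Import all_boot all_order all_algebra sesquilinear.
From mathcomp Require Import complex.
From mathcomp Require Import all_classical all_reals all_analysis.

Set Implicit Arguments.
Unset Strict Implicit.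
Unset Printing Implicit Defensive.

Import Order.TTheory GRing.Theory Num.Theory.
Import numFieldNormedType.Exports.

Local Open Scope classical_set_scope.
Local Open Scope complex_scope.
Local Open Scope ring_scope.

(* [dotp] is linear in its FIRST argument and conjugate linear in the second
   one (the convention of sesquilinear.v), so the inner product <phi, psi> of
   mathematical physics is [dotp psi phi]. *)
HB.mixin Record NormedModule_hasDot (R : realType) V
    of CompleteNormedModule R[i] V := {
  dotp : {dot V for Num.conj} ;
  dotp_norm : forall x : V, dotp x x = `|x| ^+ 2 }.

#[short(type="hilbertType")]
HB.structure Definition Hilbert (R : realType) :=
  { V of CompleteNormedModule R[i] V & NormedModule_hasDot R V }.

Definition separable (T : topologicalType) :=
  exists2 D : set T, countable D & dense D.

(* Unbounded operators: the values of [op_fun] outside [dom] are irrelevant. *)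
Record operator (V : Type) := Operator { dom : set V ; op_fun :> V -> V }.

Section Operators.
Context (R : realType) (V : hilbertType R).
Implicit Types (S T H A : operator V) (P C : V -> V).

Definition op_total C : operator V := Operator setT C.

Definition op_comp S T : operator V :=
  Operator [set psi | dom T psi /\ dom S (T psi)] (S \o T).

Definition op_sub S T : operator V :=
  Operator (dom S `&` dom T) (fun psi => S psi - T psi).

Definition op_inv T : operator V :=
  Operator (T @` dom T)
    (fun chi => xget 0 [set psi | dom T psi /\ T psi = chi]).

Definition op_eq S T : Prop :=
  dom S = dom T /\ (forall psi, dom S psi -> S psi = T psi).

Definition linear_op T : Prop :=
  dom T 0 /\ forall (a : R[i]) x y, dom T x -> dom T y ->
    dom T (a *: x + y) /\ T (a *: x + y) = a *: T x + T y.

(* Boundedness on the domain; for a densely defined operator this means that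
   it extends to a bounded operator on the whole space. *)
Definition bounded_op T : Prop :=
  exists c : R, forall psi, dom T psi -> `|T psi| <= c%:C * `|psi|.

(* The last clause says that the graphs of T and of its adjoint coincide. *)
Definition selfadjoint T : Prop :=
  [/\ linear_op T, dense (dom T) &
      forall psi chi, (dom T psi /\ T psi = chi) <->
        (forall phi, dom T phi -> dotp (T phi) psi = dotp phi chi)].

Definition is_orthogonal_projection P : Prop :=
  [/\ linear P, P \o P = P & forall x y, dotp (P x) y = dotp x (P y)].

(* The orthogonal projection onto a closed linear subspace M. *)
Definition orthogonal_projection (M : set V) : V -> V := fun psi =>
  xget 0 [set phi | M phi /\ forall eta, M eta -> dotp (psi - phi) eta = 0].

Record is_pvm (E : set R -> V -> V) : Prop := {
  pvm_proj : forall X, measurable X -> is_orthogonal_projection (E X) ;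
  pvmT : E setT = id ;
  pvm_sigma_additive : forall F : nat -> set R,
    (forall n, measurable (F n)) -> trivIset setT F ->
    forall psi, (fun n => \sum_(0 <= k < n) E (F k) psi) @ \oo -->
      E (\bigcup_n F n) psi }.

(* mu_psi(X) = <psi, E(X) psi> = ||E(X) psi||^2 *)
Definition pvm_measure (E : set R -> V -> V) (psi : V) :
    set (measurableTypeR R) -> \bar R :=
  fun X => ((complex.Re `|E X psi|) ^+ 2)%:E.

Definition integralC (mu : set (measurableTypeR R) -> \bar R) (g : R -> R[i])
    : R[i] :=
  fine (integral mu setT (fun x => (complex.Re (g x))%:E)) +i*
  fine (integral mu setT (fun x => (complex.Im (g x))%:E)).

(* The integral of g with respect to the complex measure X |-> <phi, E(X) psi>,
   this measure being expressed by polarization as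
   1/4 * \sum_(k < 4) i^k mu_(psi + i^k phi). *)
Definition pvm_form (E : set R -> V -> V) (g : R -> R[i]) (psi phi : V)
    : R[i] :=
  let i : R[i] := 'i%C in
  4%:R^-1 * \sum_(k < 4)
    i ^+ k * integralC (pvm_measure E (psi + i ^+ k *: phi)) g.

(* The operator \int g dE, on its maximal domain. *)
Definition pvm_dom (E : set R -> V -> V) (g : R -> R[i]) : set V :=
  [set psi | (integral (pvm_measure E psi) setT
    (fun x => (complex.Re (g x) ^+ 2 + complex.Im (g x) ^+ 2)%:E) < +oo)%E].

Definition pvm_integral (E : set R -> V -> V) (g : R -> R[i]) : operator V :=
  Operator (pvm_dom E g)
    (fun psi => xget 0 [set chi | forall phi, pvm_dom E g phi ->
                          dotp chi phi = pvm_form E g psi phi]).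

Definition is_spectral_measure H (E : set R -> V -> V) : Prop :=
  is_pvm E /\ op_eq H (pvm_integral E (fun x => x%:C)).

(* For selfadjoint H the spectral measure exists and is unique by the spectral
   theorem; the default value 0 is junk, and is not a projection-valued measure
   unless V = 0. *)
Definition spectral_measure H : set R -> V -> V :=
  xget (fun _ _ => 0) [set E | is_spectral_measure H E].

Definition fun_calc (g : R -> R[i]) H : operator V :=
  pvm_integral (spectral_measure H) g.

Definition real_fun_calc (f : R -> R) H : operator V :=
  fun_calc (fun x => (f x)%:C) H.

(* e^{itH} *)
Definition unitary_group H (t : R) : operator V :=
  fun_calc (fun x => cos (t * x) +i* sin (t * x)) H.

Definition ac_subspace H : set V :=
  [set psi | pvm_measure (spectral_measure H) psi `<< @lebesgue_measure R].

Definition ac_proj H : V -> V := orthogonal_projection (ac_subspace H).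

(* The sign + (t -> +oo) is [true] and the sign - (t -> -oo) is [false]. *)
Definition time_limit (s : bool) : set_system R :=
  if s then pinfty_nbhs R else ninfty_nbhs R.

(* e^{itH1} e^{-itH0} P_0^ac psi *)
Definition wave_path H1 H0 (psi : V) (t : R) : V :=
  unitary_group H1 t (unitary_group H0 (- t) (ac_proj H0 psi)).

Definition wave_op_exists (s : bool) H1 H0 : Prop :=
  forall psi, cvg (wave_path H1 H0 psi @ time_limit s).

Definition wave_op (s : bool) H1 H0 : V -> V :=
  fun psi => lim (wave_path H1 H0 psi @ time_limit s).

Definition wave_op_complete (s : bool) H1 H0 : Prop :=
  range (wave_op s H1 H0) = range (ac_proj H1).

(* The pair (H1, H0) is f-bounded. *)
Definition f_bounded (f : R -> R) H1 H0 : Prop :=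
  forall s : bool, wave_op_exists s H1 H0 /\
    bounded_op (op_comp
      (op_sub (op_total (wave_op s H1 H0))
              (op_total (ac_proj H1 \o ac_proj H0)))
      (real_fun_calc f H0)).

(* (1 - P^ac) H is bounded. *)
Definition bounded_non_ac H : Prop :=
  bounded_op (op_comp (op_total (fun psi => psi - ac_proj H psi)) H).

Definition f_equivalent (f : R -> R) H0 H1 : Prop :=
  [/\ f_bounded f H1 H0,
      forall s : bool, wave_op_complete s H1 H0,
      dom (real_fun_calc f H0) = dom (real_fun_calc f H1) &
      bounded_op (op_sub (real_fun_calc f H0) (real_fun_calc f H1))].

(* || A T^-1 || < oo *)
Definition inv_bounded A T : Prop :=
  [/\ set_inj (dom T) T, dom T `<=` dom A & bounded_op (op_comp A (op_inv T))].

(* C^* A C is bounded above (below), as the quadratic form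
   psi |-> <C psi, A C psi> on {psi | C psi \in dom A}. *)
Definition form_bounded_above A C : Prop :=
  exists c : R, forall psi, dom A (C psi) ->
    dotp (A (C psi)) (C psi) <= c%:C * `|psi| ^+ 2.

Definition form_bounded_below A C : Prop :=
  exists c : R, forall psi, dom A (C psi) ->
    c%:C * `|psi| ^+ 2 <= dotp (A (C psi)) (C psi).

End Operators.

(* Main.v *)
Require Import Defs.
From HB Require Import structures.
From mathcomp Require Import all_boot all_order all_algebra sesquilinear.
From mathcomp Require Import complex.
From mathcomp Require Import all_classical all_reals all_analysis.
From mathcomp Require Import measurable_realfun.
From mathcomp Require Import ring lra.

Set Implicit Arguments.
Unset Strict Implicit.
Unset Printing Implicit Defensive.

Import Order.TTheory GRing.Theory Num.Theory.
Import numFieldNormedType.Exports.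

Local Open Scope classical_set_scope.
Local Open Scope complex_scope.
Local Open Scope ring_scope.

(** Write W = W_s(H1,H0), P_j for the projection onto the absolutely continuous
    subspace of H_j and Q_j = 1 - P_j.  The point is that W is close to the
    identity in a way that A can see: W - 1 maps the whole space into
    dom f(H0), and f(H0) (W - 1) is bounded.  Since A f(H0)^-1 is bounded,
    A (W - 1) is then bounded too, and the forms of A at phi and at
    W phi = phi + (W - 1) phi differ by at most a multiple of |phi|^2; with
    phi = B psi both equivalences follow ([form_bounded_perturb]).

    The boundedness of f(H0) (W - 1) ([wave_op_minus_id]) comes in three steps.

    - Q_j H_j bounded means that H_j has compact spectrum on the range of Q_j,
      where the continuous function f is bounded; so Q_j f(H_j) is bounded
      ([singproj_fun_calc_bounded]).  Combined with the boundedness of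
      f(H0) - f(H1) and of (W - P_1 P_0) f(H0), this bounds (1 - W) f(H0).

    - W is a limit of isometries applied to P_0, so W preserves inner products
      up to P_0 ([wave_op_rdot]).  Hence, for phi in dom f(H0),
      <f(H0) phi, (W - 1) chi> =
        <(1 - W) f(H0) phi, W chi> - <Q_0 f(H0) phi, chi>,
      which is O(|phi| |chi|).  The operator 1 - W, which stood to the left
      of f(H0), now stands to its right.

    - f(H0) is selfadjoint, so such a bound puts (W - 1) chi in dom f(H0)
      ([truncop_adjoint], [pvm_integral_bound]).

    The functional calculus has to be built first.  For bounded measurable g
    it is the closure of linear combinations of spectral projections under
    uniform limits ([calc]); for unbounded f it is the strong limit of the
    bounded operators obtained by cutting f off where |f| > n.  Most of the
    argument uses only the real inner product Re <x, y>, which determines the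
    complex one because <x, y> = Re <x, y> + i Re <x, i y>.  If H_j had no
    spectral measure, f(H_j) would be the zero operator on the whole space and
    its injectivity would make the space trivial
    ([no_spectral_measure_trivial]); so the spectral measures may be assumed
    to exist. *)

(** * The real inner product of a Hilbert space *)

Section HilbertSpace.
Context (R : realType) (V : hilbertType R).
Implicit Types (x y z : V) (a : R).

Definition rnorm x : R := complex.Re `|x|.

Definition rdot x y : R := complex.Re (dotp x y).

Lemma norm_rnorm x : `|x| = (rnorm x)%:C.
Proof. by rewrite /rnorm RRe_real// ger0_real. Qed.

Lemma rnorm_ge0 x : 0 <= rnorm x.
Proof. rewrite -lecR -norm_rnorm; exact: normr_ge0. Qed.

Lemma rnorm0 : rnorm (0 : V) = 0.
Proof. by rewrite /rnorm normr0. Qed.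

Lemma rnorm0_eq0 x : rnorm x = 0 -> x = 0.
Proof. by move=> x0; apply/eqP; rewrite -normr_eq0 norm_rnorm x0. Qed.

Lemma rnormN x : rnorm (- x) = rnorm x.
Proof. by rewrite /rnorm normrN. Qed.

Lemma rnormD x y : rnorm (x + y) <= rnorm x + rnorm y.
Proof. by rewrite -lecR rmorphD/= -!norm_rnorm ler_normD. Qed.

Lemma rnormB x y : rnorm (x - y) <= rnorm x + rnorm y.
Proof. by rewrite -(rnormN y) rnormD. Qed.

Lemma rnormZ a x : rnorm (a%:C *: x) = `|a| * rnorm x.
Proof.
rewrite /rnorm normrZ normc_def/= expr0n addr0 sqrtr_sqr/=.
by case: `|x| => r s /=; rewrite mul0r subr0.
Qed.

Let ReJ (z : R[i]) : complex.Re (Num.conj z) = complex.Re z.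
Proof. by case: z. Qed.

Let ImJ (z : R[i]) : complex.Im (Num.conj z) = - complex.Im z.
Proof. by case: z. Qed.

Let ReZ a (z : R[i]) : complex.Re (a%:C * z) = a * complex.Re z.
Proof. by case: z => r s /=; rewrite mul0r subr0. Qed.

Let ReMi (z : R[i]) : complex.Re ('i%C * z) = - complex.Im z.
Proof. by case: z => r s /=; rewrite mul0r mul1r sub0r. Qed.

Lemma rdotC x y : rdot x y = rdot y x.
Proof.
rewrite /rdot (hermC dotp) expr0 mul1r.
exact: (ReJ (dotp y x)).
Qed.

Lemma rdotDl x y z : rdot (x + y) z = rdot x z + rdot y z.
Proof. by rewrite /rdot (linearDl dotp) raddfD. Qed.

Lemma rdotDr x y z : rdot x (y + z) = rdot x y + rdot x z.
Proof. by rewrite !(rdotC x) rdotDl. Qed.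

Lemma rdotNl x y : rdot (- x) y = - rdot x y.
Proof. by rewrite /rdot (linearNl dotp) raddfN. Qed.

Lemma rdotNr x y : rdot x (- y) = - rdot x y.
Proof. by rewrite !(rdotC x) rdotNl. Qed.

Lemma rdotBl x y z : rdot (x - y) z = rdot x z - rdot y z.
Proof. by rewrite rdotDl rdotNl. Qed.

Lemma rdotBr x y z : rdot x (y - z) = rdot x y - rdot x z.
Proof. by rewrite rdotDr rdotNr. Qed.

Lemma rdotZl a x y : rdot (a%:C *: x) y = a * rdot x y.
Proof.
by rewrite /rdot (linearZl_LR dotp) (ReZ a (dotp x y)).
Qed.

Lemma rdotZr a x y : rdot x (a%:C *: y) = a * rdot x y.
Proof. by rewrite !(rdotC x) rdotZl. Qed.

Lemma rdot0l x : rdot 0 x = 0.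
Proof. by rewrite -(subrr x) rdotBl subrr. Qed.

Lemma rdot0r x : rdot x 0 = 0.
Proof. by rewrite rdotC rdot0l. Qed.

Lemma Re_dotp_il x y : complex.Re (dotp ('i%C *: x) y) = - complex.Im (dotp x y).
Proof.
by rewrite (linearZl_LR dotp) (ReMi (dotp x y)).
Qed.

Lemma rdot_i x y : rdot ('i%C *: x) y = - rdot x ('i%C *: y).
Proof.
rewrite (rdotC x) /rdot !Re_dotp_il (hermC dotp x) expr0 mul1r.
by rewrite (ImJ (dotp y x)).
Qed.

Lemma rdotxx x : rdot x x = rnorm x ^+ 2.
Proof. by rewrite /rdot dotp_norm norm_rnorm -rmorphXn. Qed.

Lemma rdot_le x y : rdot x y <= rnorm x * rnorm y.
Proof.
have : rnorm (x + y) ^+ 2 <= (rnorm x + rnorm y) ^+ 2.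
  by rewrite ler_pXn2r ?nnegrE ?addr_ge0 ?rnorm_ge0 ?rnormD.
rewrite -rdotxx rdotDl !rdotDr !rdotxx (rdotC y x); lra.
Qed.

Lemma rdot_norm x y : `|rdot x y| <= rnorm x * rnorm y.
Proof.
by rewrite ler_norml rdot_le andbT lerNl -rdotNl -[rnorm x]rnormN rdot_le.
Qed.

(** Cancels one factor u in u^2 <= c u, which is how every operator bound
    below is obtained from a bound on an inner product. *)
Lemma le_of_sqr_le_mul (u c : R) : 0 <= u -> 0 <= c -> u ^+ 2 <= c * u -> u <= c.
Proof.
move=> u0 c0; rewrite expr2; have [->//|un0] := eqVneq u 0.
by rewrite ler_pM2r// lt0r un0.
Qed.

Lemma dotp_decomp x y :
  dotp x y = Complex (rdot x y) (rdot x ('i%C *: y)).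
Proof.
have -> : rdot x ('i%C *: y) = complex.Im (dotp x y).
  by rewrite -[LHS]opprK -rdot_i /rdot Re_dotp_il opprK.
by rewrite /rdot; case: (dotp x y).
Qed.

Lemma rdot_inj x y : (forall z, rdot x z = rdot y z) -> x = y.
Proof.
move=> xy; apply/eqP; rewrite -subr_eq0; apply/eqP/rnorm0_eq0/eqP.
by rewrite -sqrf_eq0 -rdotxx rdotBl xy subrr.
Qed.

Lemma cvgV_rnormP {T} {F : set_system T} {FF : Filter F} (u : T -> V) x :
  u @ F --> x <-> forall e : R, 0 < e -> \forall t \near F, rnorm (x - u t) <= e.
Proof.
split=> [/cvgrPdist_le ux e e0|ux].
  have := ux e%:C; rewrite ltcR => /(_ e0).
  by apply: filterS => t; rewrite norm_rnorm lecR.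
apply/cvgrPdist_le => -[e e']; rewrite ltcE/= => /andP[/eqP-> e0].
by apply: filterS (ux _ e0) => t; rewrite norm_rnorm lecR.
Qed.

Lemma cvgV_unique {T} {F : set_system T} {FF : ProperFilter F} (u : T -> V) x y :
  u @ F --> x -> u @ F --> y -> x = y.
Proof. exact: cvg_unique. Qed.

Lemma cvgR_unique {T} {F : set_system T} {FF : ProperFilter F} (u : T -> R) (a b : R) :
  u @ F --> a -> u @ F --> b -> a = b.
Proof. exact: cvg_unique. Qed.

Lemma cauchyV (u : nat -> V) :
  (forall e : R, 0 < e -> exists N, forall n m, (N <= n)%N -> (N <= m)%N ->
     rnorm (u n - u m) <= e) -> exists x, u @ \oo --> x.
Proof.
move=> uc; suff : cvg (u @ \oo) by move=> /cvg_ex[x ux]; exists x.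
apply/cauchy_cvgP/cauchy_ballP => -[e e']; rewrite ltcE/= => /andP[/eqP-> e0].
have [|N uN] := uc (e / 2); first by rewrite divr_gt0.
near_simpl; near=> n m; rewrite -ball_normE/= norm_rnorm ltcR.
apply: (@le_lt_trans _ _ (e / 2)); last by rewrite ltr_pdivrMr// ltr_pMr// ltr1n.
by apply: uN; [near: n|near: m]; exact: nbhs_infty_ge.
Unshelve. all: by end_near. Qed.

Lemma cvgV_cst {T} {F : set_system T} {FF : Filter F} x :
  (fun _ : T => x) @ F --> x.
Proof. exact: cvg_cst. Qed.

Lemma cvgVD {T} {F : set_system T} {FF : Filter F} (u v : T -> V) x y :
  u @ F --> x -> v @ F --> y -> (fun t => u t + v t) @ F --> x + y.
Proof. by move=> ux vy; exact: cvgD. Qed.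

Lemma cvgVZ {T} {F : set_system T} {FF : Filter F} (c : R[i]) (u : T -> V) x :
  u @ F --> x -> (fun t => c *: u t) @ F --> c *: x.
Proof. by move=> ux; exact: cvgZr. Qed.

Lemma cvgVN {T} {F : set_system T} {FF : Filter F} (u : T -> V) x :
  u @ F --> x -> (fun t => - u t) @ F --> - x.
Proof. by move=> ux; exact: cvgN. Qed.

Lemma cvgVB {T} {F : set_system T} {FF : Filter F} (u v : T -> V) x y :
  u @ F --> x -> v @ F --> y -> (fun t => u t - v t) @ F --> x - y.
Proof. by move=> ux vy; apply: cvgVD => //; exact: cvgVN. Qed.

Lemma cvgV_near_eq {T} {F : set_system T} {FF : Filter F} (u v : T -> V) x :
  (\forall t \near F, u t = v t) -> u @ F --> x -> v @ F --> x.
Proof.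
move=> uv /cvgV_rnormP ux; apply/cvgV_rnormP => e /ux; apply: filterS2 uv => t <-//.
Qed.

Lemma cvgV_bounded {T} {F : set_system T} {FF : Filter F} (G : V -> V) (c : R)
    (u : T -> V) x :
  (forall y z, rnorm (G y - G z) <= c * rnorm (y - z)) ->
  u @ F --> x -> (fun t => G (u t)) @ F --> G x.
Proof.
move=> Gc /cvgV_rnormP ux; apply/cvgV_rnormP => e e0.
have c0 : 0 < `|c| + 1 by rewrite ltr_wpDl.
have := ux (e / (`|c| + 1)); rewrite divr_gt0// => /(_ isT).
apply: filterS => t; rewrite ler_pdivlMr// => h.
apply: le_trans (Gc _ _) (le_trans _ h); rewrite mulrC ler_wpM2l ?rnorm_ge0//.
by rewrite (le_trans (ler_norm _))// lerDl.
Qed.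

Lemma cvg_rdot {T} {F : set_system T} {FF : Filter F} (u v : T -> V) x y :
  u @ F --> x -> v @ F --> y -> (fun t => rdot (u t) (v t)) @ F --> rdot x y.
Proof.
move=> /cvgV_rnormP ux /cvgV_rnormP vy; apply/cvgrPdist_le => e e0.
(* d <= 1 absorbs the product of the two increments. *)
pose d := Num.min 1 (e / (rnorm x + rnorm y + 1)).
have k0 : 0 < rnorm x + rnorm y + 1 by rewrite ltr_wpDl// addr_ge0 ?rnorm_ge0.
have d0 : 0 < d by rewrite lt_min ltr01/= divr_gt0.
have d1 : d <= 1 by rewrite ge_min lexx.
have de : d * (rnorm x + rnorm y + 1) <= e.
  by rewrite -ler_pdivlMr// ge_min lexx orbT.
move: (ux _ d0) (vy _ d0); apply: filterS2 => t uxt vyt.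
have -> : rdot x y - rdot (u t) (v t) =
    rdot (x - u t) y + rdot x (y - v t) - rdot (x - u t) (y - v t).
  by rewrite !rdotBl !rdotBr; ring.
have h1 : `|rdot (x - u t) y| <= d * rnorm y.
  by apply: le_trans (rdot_norm _ _) _; rewrite ler_wpM2r ?rnorm_ge0.
have h2 : `|rdot x (y - v t)| <= d * rnorm x.
  by apply: le_trans (rdot_norm _ _) _; rewrite mulrC ler_wpM2r ?rnorm_ge0.
have h3 : `|rdot (x - u t) (y - v t)| <= d * 1.
  apply: le_trans (rdot_norm _ _) _; rewrite ler_pM ?rnorm_ge0//.
  exact: le_trans d1.
apply: le_trans (ler_normB _ _) _; apply: le_trans (lerD (ler_normD _ _) (lexx _)) _.
apply: le_trans de; lra.
Qed.

Lemma cvg_rnorm_sqr {T} {F : set_system T} {FF : Filter F} (u : T -> V) x :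
  u @ F --> x -> (fun t => rnorm (u t) ^+ 2) @ F --> rnorm x ^+ 2.
Proof.
move=> ux; rewrite -rdotxx (_ : (fun t => _) = fun t => rdot (u t) (u t)).
  exact: cvg_rdot.
by apply/funext => t; rewrite rdotxx.
Qed.
End HilbertSpace.
Arguments cvgV_cst {R V T F FF} x.
Arguments cvgVZ {R V T F FF} c {u x} _.

(** * Projection-valued measures *)

Section Linear.
Context (R : realType) (V : hilbertType R).
Implicit Types (G : V -> V).

Lemma linD G : linear G -> forall x y, G (x + y) = G x + G y.
Proof. by move=> l x y; have := l 1 x y; rewrite !scale1r. Qed.

Lemma lin0 G : linear G -> G 0 = 0.
Proof. by move=> l; apply: (addIr (G 0)); rewrite -(linD l) !add0r. Qed.

Lemma linZ G : linear G -> forall a x, G (a *: x) = a *: G x.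
Proof. by move=> l a x; have := l a x 0; rewrite (lin0 l) !addr0. Qed.

Lemma linN G : linear G -> forall x, G (- x) = - G x.
Proof. by move=> l x; rewrite -scaleN1r (linZ l) scaleN1r. Qed.

Lemma linB G : linear G -> forall x y, G (x - y) = G x - G y.
Proof. by move=> l x y; rewrite (linD l) (linN l). Qed.

Definition rsym G := forall x y, rdot (G x) y = rdot x (G y).

End Linear.

Section PVM.
Context (R : realType) (V : hilbertType R).
Variables (E : set R -> V -> V) (pE : is_pvm E).
Implicit Types (X Y : set (measurableTypeR R)) (x y : V).

Lemma pvm_lin X : measurable X -> linear (E X).
Proof. by move=> /(pvm_proj pE)[]. Qed.

Lemma pvm_idem X x : measurable X -> E X (E X x) = E X x.
Proof. by move=> /(pvm_proj pE)[_ + _] => /(congr1 (@^~ x)). Qed.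

Lemma pvm_sym X : measurable X -> rsym (E X).
Proof. by move=> /(pvm_proj pE)[_ _ s] x y; rewrite /rdot s. Qed.

Lemma pvm_diag X x : measurable X -> rdot (E X x) x = rnorm (E X x) ^+ 2.
Proof. by move=> mX; rewrite -pvm_idem// pvm_sym// rdotxx pvm_idem. Qed.

Lemma pvm_contract X x : measurable X -> rnorm (E X x) <= rnorm x.
Proof.
move=> mX; apply: le_of_sqr_le_mul; rewrite ?rnorm_ge0//.
by rewrite -pvm_diag// mulrC rdot_le.
Qed.

Lemma pvm0 x : E set0 x = 0.
Proof.
have F0 : forall n : nat, measurable (set0 : set (measurableTypeR R)) by [].
(* The partial sums of the constant sequence E(set0) x converge, so their
   constant increment vanishes. *)
have := @pvm_sigma_additive _ _ _ pE (fun=> set0) F0.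
have -> : \bigcup_(n : nat) (set0 : set R) = set0 by exact: bigcup0.
move=> /(_ (@trivIset_set0 _ _ _) x) u.
have uS := u; rewrite -cvg_shiftS in uS.
rewrite -[RHS](subrr (E set0 x)); apply: cvgV_unique (cvgVB uS u).
apply: (@cvgV_near_eq _ _ _ \oo _ (fun=> E set0 x)); last exact: cvgV_cst.
apply: nearW => n /=; by rewrite big_nat_recr//= addrAC subrr add0r.
Qed.

Lemma pvm_add X Y x : measurable X -> measurable Y -> X `&` Y = set0 ->
  E (X `|` Y) x = E X x + E Y x.
Proof.
move=> mX mY XY.
have mF n : measurable (bigcup2 X Y n) by rewrite /bigcup2; do 2?case: ifP => _ //.
have tF : trivIset setT (bigcup2 X Y).
  by rewrite -trivIset_bigcup2.
have := @pvm_sigma_additive _ _ _ pE _ mF tF x; rewrite bigcup2E => u.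
apply: (cvgV_unique u); rewrite -cvg_shiftS -cvg_shiftS.
apply: (@cvgV_near_eq _ _ _ \oo _ (fun=> E X x + E Y x)); last exact: cvgV_cst.
apply: nearW => n /=.
rewrite 2?big_nat_recl//= big1 ?addr0 1?addrC//.
by move=> i _; rewrite pvm0.
Qed.

(** If the sum of two projections is a projection, their ranges are
    orthogonal: with y = E(Y)x, the numbers |E(X)y|^2 + |y|^2 and
    |E(X u Y)y|^2 are equal, and the latter is at most |y|^2. *)
Lemma pvm_disj X Y x : measurable X -> measurable Y -> X `&` Y = set0 ->
  E X (E Y x) = 0.
Proof.
move=> mX mY XY; apply/rnorm0_eq0/eqP; rewrite -sqrf_eq0 -pvm_diag//.
set y := E Y x.
have : rdot (E (X `|` Y) y) y <= rnorm y ^+ 2.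
  rewrite pvm_diag; last exact: measurableU.
  by rewrite ler_pXn2r ?nnegrE ?rnorm_ge0// pvm_contract//; exact: measurableU.
rewrite pvm_add// rdotDl [E Y y]pvm_idem// -/y rdotxx gerDr => le0.
by apply/eqP/le_anti; rewrite le0 pvm_diag// sqr_ge0.
Qed.

Lemma pvm_comp X Y x : measurable X -> measurable Y ->
  E X (E Y x) = E (X `&` Y) x.
Proof.
move=> mX mY.
have mI : measurable (X `&` Y) by exact: measurableI.
have mD : measurable (X `\` Y) by exact: measurableD.
have mD' : measurable (Y `\` X) by exact: measurableD.
have split X' Y' z : measurable X' -> measurable Y' ->
    E X' z = E (X' `&` Y') z + E (X' `\` Y') z.
  move=> mX' mY'; rewrite -[in LHS](setUIDK X' Y') pvm_add//.
  - exact: measurableI.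
  - exact: measurableD.
  - by rewrite setDE setIACA setICr setI0.
rewrite (split Y X x)// (linD (pvm_lin mX)) (pvm_disj _ mX mD'); last first.
  by rewrite setDE setICA setICr setI0.
rewrite addr0 setIC (split X Y)// pvm_idem// pvm_disj ?addr0//.
by rewrite setDE setIACA setICl setI0.
Qed.

Variable psi : V.

Local Notation mu := (pvm_measure E psi).

Let mu0 : mu set0 = 0%E.
Proof. by rewrite /pvm_measure pvm0 normr0 expr0n. Qed.

Let mu_ge0 X : (0 <= mu X)%E.
Proof. by rewrite lee_fin sqr_ge0. Qed.

Let mu_sigma : semi_sigma_additive mu.
Proof.
move=> F mF tF mUF.
have := @pvm_sigma_additive _ _ _ pE _ mF tF psi.
move=> /(fun h => cvg_rdot h (cvg_cst psi)); rewrite pvm_diag// => h.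
rewrite (_ : (fun n => _) = EFin \o
    (fun n => rdot (\sum_(0 <= k < n) E (F k) psi) psi)).
  by apply/fine_cvgP; split; [exact: nearW|exact: h].
apply/funext => n /=; elim: n => [|n IH]; first by rewrite !big_nil rdot0l.
by rewrite !big_nat_recr//= IH rdotDl EFinD pvm_diag.
Qed.

HB.instance Definition _ := isMeasure.Build _ _ _ mu mu0 mu_ge0 mu_sigma.

Let mu_fin : fin_num_fun mu.
Proof. by []. Qed.

HB.instance Definition _ := @Measure_isFinite.Build _ _ _ mu mu_fin.

Definition pvm_mu : {finite_measure set (measurableTypeR R) -> \bar R} := mu.

End PVM.

(** * The functional calculus for bounded functions *)

Section Calculus.
Context (R : realType) (V : hilbertType R).
Variables (E : set R -> V -> V) (pE : is_pvm E).
Local Notation T := (measurableTypeR R).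
Local Notation mu := (pvm_mu pE).
Implicit Types (G H : V -> V) (g h : R -> R) (x y : V).

Definition bmeas g := measurable_fun setT (g : T -> R) /\
  exists M, forall t, `|g t| <= M.

(** [calc G g] says that G is the operator g(H).  Taking an inductive closure
    that already contains the uniform limits makes multiplicativity and
    symmetry provable by plain induction. *)
Inductive calc : (V -> V) -> (R -> R) -> Prop :=
| calc_E X : measurable (X : set T) -> calc (E X) \1_X
| calc_D G g H h : calc G g -> calc H h ->
    calc (fun x => G x + H x) (fun t => g t + h t)
| calc_Z (a : R) G g : calc G g ->
    calc (fun x => a%:C *: G x) (fun t => a * g t)
| calc_lim (Gn : nat -> V -> V) (gn : nat -> R -> R) G g :
    (forall n, calc (Gn n) (gn n)) ->
    (forall e : R, 0 < e -> \forall n \near \oo, forall t, `|g t - gn n t| <= e) ->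
    (forall x, (fun n => Gn n x) @ \oo --> G x) -> calc G g.

Lemma bmeas_integrable g x : bmeas g ->
  (mu x).-integrable setT (EFin \o (g : T -> R)).
Proof.
move=> [mg [M gM]]; apply: measurable_bounded_integrable => //.
  by rewrite ltry.
exists M; split; first exact: num_real.
by move=> N MN t _; exact: le_trans (gM t) (ltW MN).
Qed.

Lemma bmeasD g h : bmeas g -> bmeas h -> bmeas (fun t => g t + h t).
Proof.
move=> [mg [M gM]] [mh [N hN]]; split; first exact: measurable_funD.
by exists (M + N) => t; exact: le_trans (ler_normD _ _) (lerD _ _).
Qed.

Lemma bmeasM g h : bmeas g -> bmeas h -> bmeas (fun t => g t * h t).
Proof.
move=> [mg [M gM]] [mh [N hN]]; split; first exact: measurable_funM.
by exists (M * N) => t; rewrite normrM ler_pM.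
Qed.

Lemma bmeas_cst (c : R) : bmeas (fun=> c).
Proof. by split; [exact: measurable_cst|exists `|c|]. Qed.

Lemma bmeas_indic (X : set T) : measurable X -> bmeas \1_X.
Proof.
move=> mX; split; first exact: measurable_indic.
by exists 1 => t; rewrite indicE; case: (_ \in _); rewrite ?normr0 ?normr1.
Qed.

Lemma bmeas_lim (gn : nat -> R -> R) g : (forall n, bmeas (gn n)) ->
  (forall e : R, 0 < e -> \forall n \near \oo, forall t, `|g t - gn n t| <= e) ->
  bmeas g.
Proof.
move=> bg gng; split.
  apply: (@measurable_fun_cvg _ _ _ _ gn).
    by move=> n; have [] := bg n.
  move=> t _; apply/cvgrPdist_le => e /gng; apply: filterS => n; exact.
have [N _ /(_ N (leqnn _)) gN] := gng 1 ltr01.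
have [_ [M gM]] := bg N; exists (1 + M) => t.
rewrite -(subrK (gn N t) (g t)).
by apply: le_trans (ler_normD _ _) (lerD _ _).
Qed.

Lemma bmeasB g h : bmeas g -> bmeas h -> bmeas (fun t => g t - h t).
Proof.
move=> bg bh; have := bmeasD bg (bmeasM (bmeas_cst (-1)) bh).
by congr bmeas; apply/funext => t; rewrite mulN1r.
Qed.

Lemma int_bmeasB g h x : bmeas g -> bmeas h ->
  \int[mu x]_t (g t - h t) = \int[mu x]_t g t - \int[mu x]_t h t.
Proof. by move=> bg bh; rewrite RintegralB//; exact: bmeas_integrable. Qed.

Lemma le_int_bmeas g h x : bmeas g -> bmeas h -> (forall t, g t <= h t) ->
  \int[mu x]_t g t <= \int[mu x]_t h t.
Proof. by move=> bg bh gh; apply: le_Rintegral => //; exact: bmeas_integrable. Qed.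

Lemma mu_setT x : fine (mu x setT) = rnorm x ^+ 2.
Proof. by rewrite /= (pvmT pE). Qed.

(** The diagonal form of g(H) is the integral of g against the spectral
    measure of x; uniform limits pass to the integral since that measure
    has finite total mass |x|^2. *)
Lemma calcP G g : calc G g ->
  [/\ linear G, rsym G, bmeas g &
      forall x, rdot (G x) x = \int[mu x]_t g t].
Proof.
elim=> {G g} [X mX|G g H h _ [lG sG bg Gg] _ [lH sH bh Hh]
    |a G g _ [lG sG bg Gg]|Gn gn G g _ IH gng GnG].
- split; [exact: pvm_lin|exact: pvm_sym|exact: bmeas_indic|] => x.
  by rewrite pvm_diag// /Rintegral integral_indic// setIT.
- split.
  + by move=> a x y; rewrite lG lH scalerDr addrACA.
  + by move=> x y; rewrite rdotDl rdotDr sG sH.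
  + exact: bmeasD.
  + move=> x; rewrite rdotDl Gg Hh RintegralD//; exact: bmeas_integrable.
- split.
  + by move=> b x y; rewrite lG scalerDr !scalerA mulrC.
  + by move=> x y; rewrite rdotZl rdotZr sG.
  + exact: bmeasM (bmeas_cst a) bg.
  + move=> x; rewrite rdotZl Gg RintegralZl//; exact: bmeas_integrable.
- have bg : bmeas g.
    by apply: bmeas_lim gng => n; have [] := IH n.
  split => //.
  + move=> a x y; apply: (cvgV_unique (GnG _)).
    apply: (@cvgV_near_eq _ _ _ _ _ (fun n => a *: Gn n x + Gn n y)).
      by apply: nearW => n; have [lG _ _ _] := IH n; rewrite lG.
    exact: cvgVD (cvgVZ a (GnG x)) (GnG y).
  + move=> x y.
    apply: (cvgR_unique (cvg_rdot (GnG x) (cvgV_cst y))).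
    have -> : (fun n => rdot (Gn n x) y) = (fun n => rdot x (Gn n y)).
      by apply/funext => n; have [_ sG _ _] := IH n.
    exact: cvg_rdot (cvgV_cst x) (GnG y).
  + move=> x.
    apply: (cvgR_unique (cvg_rdot (GnG x) (cvgV_cst x))).
    apply/cvgrPdist_le => e e0.
    have k0 : 0 < rnorm x ^+ 2 + 1 by rewrite ltr_wpDl// sqr_ge0.
    have := gng (e / (rnorm x ^+ 2 + 1)); rewrite divr_gt0// => /(_ isT).
    apply: filterS => n.
    set d := e / _ => le_e; have [_ _ bn ->] := IH n.
    rewrite -int_bmeasB//.
    have de : d * rnorm x ^+ 2 <= e.
      by rewrite /d mulrAC ler_pdivrMr// ler_wpM2l// ?ltW// ltrDl.
    apply: le_trans de; rewrite ler_norml -mulNr -!mu_setT -!Rintegral_cst//.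
    apply/andP; split; (apply: le_int_bmeas; [|
      |by move=> t; have := le_e t; rewrite ler_norml => /andP[]]);
      by [exact: bmeas_cst|exact: bmeasB].
Qed.

Lemma calc_eq G g H h : G = H -> g = h -> calc G g -> calc H h.
Proof. by move=> -> ->. Qed.

(** Multiplicativity holds for indicators because spectral projections
    multiply like indicators; it extends first in the right factor, where
    E(X) is a contraction, then in the left factor, where the right function
    is bounded. *)
Lemma calc_M G g H h : calc G g -> calc H h ->
  calc (G \o H) (fun t => g t * h t).
Proof.
move=> cG cH; have [lH _ [_ [M hM]] _] := calcP cH.
elim: cG => {G g} [X mX|G g G' g' _ IH _ IH'|a G g _ IH|Gn gn G g _ IH gng GnG].
- elim: cH {lH hM} => {H h} [Y mY|H h H' h' _ IH _ IH'|a H h _ IH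
      |Hn hn H h _ IH hnh HnH].
  + have -> : E X \o E Y = E (X `&` Y).
      by apply/funext => x /=; exact: pvm_comp.
    have -> : (fun t => \1_X t * \1_Y t) = \1_(X `&` Y) :> (R -> R).
      by rewrite indicI.
    by apply: calc_E; exact: measurableI.
  + apply: calc_eq (calc_D IH IH').
    * by apply/funext => x /=; rewrite (linD (pvm_lin pE mX)).
    * by apply/funext => t; rewrite mulrDr.
  + apply: calc_eq (calc_Z a IH).
    * by apply/funext => x /=; rewrite (linZ (pvm_lin pE mX)).
    * by apply/funext => t; rewrite mulrCA.
  + apply: (calc_lim IH) => [e e0|x].
      apply: filterS (hnh e e0) => n le_e t.
      rewrite -mulrBr normrM -[leRHS]mul1r ler_pM//.
      by rewrite indicE; case: (_ \in _); rewrite ?normr0 ?normr1.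
    apply: (cvgV_bounded (c := 1)) (HnH x) => y z.
    by rewrite -(linB (pvm_lin pE mX)) mul1r pvm_contract.
- apply: calc_eq (calc_D IH IH') => //.
  by apply/funext => t; rewrite mulrDl.
- apply: calc_eq (calc_Z a IH) => //.
  by apply/funext => t; rewrite mulrA.
- apply: (calc_lim IH) => [e e0|x]; last exact: GnG.
  have k0 : 0 < `|M| + 1 by rewrite ltr_wpDl.
  have := gng (e / (`|M| + 1)); rewrite divr_gt0// => /(_ isT).
  apply: filterS => n le_e t; rewrite -mulrBl normrM.
  apply: (@le_trans _ _ (e / (`|M| + 1) * (`|M| + 1))).
    rewrite ler_pM//; apply: le_trans (hM t) _.
    by rewrite (le_trans (ler_norm M))// lerDl.
  by rewrite divfK// gt_eqF.
Qed.

(** |g(H)x|^2 = <g(H)^2 x, x>, and g(H)^2 is the operator of g^2. *)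
Lemma calc_norm G g x : calc G g -> rnorm (G x) ^+ 2 = \int[mu x]_t (g t ^+ 2).
Proof.
move=> cG; have [_ sG _ _] := calcP cG.
have [_ _ _ GG] := calcP (calc_M cG cG).
by rewrite -rdotxx -sG; exact: GG.
Qed.

Lemma calc_B G g H h : calc G g -> calc H h ->
  calc (fun x => G x - H x) (fun t => g t - h t).
Proof.
move=> cG cH; apply: calc_eq (calc_D cG (calc_Z (-1) cH)).
  by apply/funext => x; rewrite rmorphN rmorph1 scaleN1r.
by apply/funext => t; rewrite mulN1r.
Qed.

Lemma calc_le G g H h x : calc G g -> calc H h ->
  (forall t, `|g t| <= `|h t|) -> rnorm (G x) <= rnorm (H x).
Proof.
move=> cG cH gh; rewrite -(@ler_pXn2r _ 2)// ?nnegrE ?rnorm_ge0//.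
rewrite (calc_norm _ cG) (calc_norm _ cH).
have [_ _ bg _] := calcP cG; have [_ _ bh _] := calcP cH.
apply: le_int_bmeas; [exact: bmeasM|exact: bmeasM|move=> t].
by rewrite -(real_normK (num_real (g t))) -(real_normK (num_real (h t))) ler_pXn2r ?nnegrE.
Qed.

Lemma calc_id : calc id (fun=> 1).
Proof.
apply: calc_eq (calc_E measurableT); first by rewrite (pvmT pE).
by apply/funext => t; rewrite indicE in_setT.
Qed.

Lemma calc_bound G g (M : R) x : calc G g ->
  (forall t, `|g t| <= M) -> rnorm (G x) <= M * rnorm x.
Proof.
move=> cG gM; have M0 : 0 <= M by apply: le_trans (gM 0).
rewrite -[M in leRHS]ger0_norm// -rnormZ.
apply: (calc_le x cG (calc_Z M calc_id)) => t.
by rewrite mulr1 (ger0_norm M0).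
Qed.

Lemma calc_uniq G H g x : calc G g -> calc H g -> G x = H x.
Proof.
move=> cG cH; apply/eqP; rewrite -subr_eq0; apply/eqP/rnorm0_eq0/le_anti.
rewrite rnorm_ge0 andbT -(mul0r (rnorm x)).
by apply: (calc_bound x (calc_B cG cH)) => t; rewrite subrr normr0.
Qed.

(** One binary digit at a time: subtracting c/2 where g >= c/2 leaves a
    function with values in [0, c/2]. *)
Lemma calc_binary_approx n (c : R) g : measurable_fun setT (g : T -> R) ->
  (forall t, 0 <= g t <= c) ->
  exists G h, calc G h /\ forall t, 0 <= g t - h t <= c / 2 ^+ n.
Proof.
elim: n c g => [|n IH] c g mg gc.
  exists (fun x => (0 : R)%:C *: x), (fun=> 0 * 1); split.
    exact: calc_Z calc_id.
  by move=> t; rewrite mul0r subr0 expr0 divr1.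
pose X := [set t : T | c / 2 <= g t].
have mX : measurable X.
  rewrite (_ : X = setT `&` g @^-1` `[c / 2, +oo[%classic).
    exact: mg.
  by rewrite setTI; apply/seteqP; split => t /=; rewrite in_itv/= andbT.
have [|t|G [h [cG gh]]] := IH (c / 2) (fun t => g t - c / 2 * \1_X t).
- apply: measurable_funB => //; apply: measurable_funM => //.
- have := gc t; rewrite indicE; have [tX|tX] := boolP (t \in X).
    by move: tX; rewrite inE /X/= => ?; lra.
  by move: tX; rewrite notin_setE /X/= => /negP; rewrite -ltNge => ?; lra.
exists (fun x => G x + (c / 2)%:C *: E X x), (fun t => h t + c / 2 * \1_X t).
split; first exact: calc_D cG (calc_Z _ (calc_E mX)).
move=> t; have := gh t; rewrite exprS invfM mulrA opprD addrA.
by rewrite [g t - _ - _]addrAC.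
Qed.

Lemma calc_exists g : bmeas g -> exists G, calc G g.
Proof.
move=> [mg [M gM]].
have M0 : 0 <= M by apply: le_trans (gM 0).
suff [G cG] : exists G, calc G (fun t => g t + M).
  (* Shifting by M makes the function nonnegative, as the expansion requires. *)
  exists (fun x => G x - (M%:C *: x)).
  apply: calc_eq (calc_B cG (calc_Z M calc_id)) => //.
  by apply/funext => t; rewrite mulr1 addrK.
set f := fun t => g t + M.
have mf : measurable_fun setT (f : T -> R) by exact: measurable_funD.
have fM t : 0 <= f t <= 2 * M.
  by have := gM t; rewrite ler_norml /f => /andP[? ?]; lra.
have /choice[Gh Gh_] := fun n => (let: ex_intro G (ex_intro h p) :=
  @calc_binary_approx n _ _ mf fM in ex_intro (fun q => calc q.1 q.2 /\
   forall t, 0 <= f t - q.2 t <= 2 * M / 2 ^+ n) (G, h) p).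
pose Gn n := (Gh n).1; pose gn n := (Gh n).2.
have cGn n : calc (Gn n) (gn n) by have [] := Gh_ n.
have unif (e : R) : 0 < e -> \forall n \near \oo, forall t, `|f t - gn n t| <= e.
  move=> e0; have : (fun n => 2 * M * (2^-1) ^+ n) @ \oo --> (2 * M * 0 : R).
    by apply: cvgMr; apply: cvg_expr; rewrite ger0_norm// invf_lt1// ltr1n.
  rewrite mulr0 => /cvgrPdist_le /(_ _ e0); apply: filterS => n.
  rewrite sub0r normrN => le_e t; have [_ /(_ t)/andP[h0 h1]] := Gh_ n.
  rewrite ger0_norm//; apply: le_trans h1 _; rewrite -exprVn.
  exact: le_trans (ler_norm _) le_e.
have cvgG x : exists y, (fun n => Gn n x) @ \oo --> y.
  apply: cauchyV => e e0.
  have k0 : 0 < rnorm x + 1 by rewrite ltr_wpDl// rnorm_ge0.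
  have [|N _ uN] := unif (e / (rnorm x + 1) / 2); first by rewrite !divr_gt0.
  exists N => n m Nn Nm.
  apply: le_trans (calc_bound (M := e / (rnorm x + 1)) x (calc_B (cGn n) (cGn m)) _) _.
    move=> t; have h1 := uN n Nn t; have h2 := uN m Nm t.
    rewrite -[_ - _](subrKA (f t)).
    apply: le_trans (ler_normD _ _) _; rewrite (distrC (gn n t)).
    by rewrite [leRHS]splitr lerD.
  by rewrite mulrAC ler_pdivrMr// ler_wpM2l// ?ltW// ltrDl.
have /choice[G GnG] := cvgG.
by exists G; exact: calc_lim cGn unif GnG.
Qed.

End Calculus.

(** * Truncations of an unbounded function *)

Section Polarization.
Context (R : realType) (V : hilbertType R).

(** Here u and v stand for the images of psi and phi under a symmetric
    operator that is defined on all their linear combinations, so that the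
    sum is the polarization used in the definition of the integral of a
    function against a projection-valued measure. *)
Lemma polarization (u v psi phi : V) :
  rdot u phi = rdot psi v -> rdot u ('i%C *: phi) = rdot psi ('i%C *: v) ->
  4%:R^-1 * (\sum_(k < 4) 'i%C ^+ k *
    (rdot (u + 'i%C ^+ k *: v) (psi + 'i%C ^+ k *: phi))%:C) = dotp u phi.
Proof.
move=> h1 h2; rewrite dotp_decomp.
rewrite !big_ord_recl big_ord0 /= addr0 /bump/=.
have i2 : ('i%C : R[i]) ^+ 2 = -1 by rewrite sqr_i.
have i3 : ('i%C : R[i]) ^+ 3 = - 'i%C by rewrite exprS i2 mulrN1.
rewrite !expr0 !expr1 i2 i3 !scale1r !scaleN1r !scaleNr.
rewrite !rdotDl !rdotDr !rdotNl !rdotNr !opprK.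
rewrite (rdotC v psi) (rdotC ('i%C *: v) psi) -h1 -h2.
have n4 : 4%:R != 0 :> R[i] by rewrite pnatr_eq0.
apply: (canLR (mulKf n4)).
apply/eqP; rewrite eq_complex /=; apply/andP; split; apply/eqP; ring.
Qed.

End Polarization.

Section Unbounded.
Context (R : realType) (V : hilbertType R).
Variables (E : set R -> V -> V) (pE : is_pvm E).
Local Notation T := (measurableTypeR R).
Local Notation mu := (pvm_mu pE).
Variables (f : R -> R) (mf : measurable_fun setT (f : T -> R)).
Implicit Types (psi phi : V).

(** By [calc_uniq] the chosen value does not depend on the operator G. *)
Definition bcalc (g : R -> R)  (x : V) : V :=
  xget 0 [set y | exists2 G, calc E G g & G x = y].

Lemma bcalcP g : bmeas g -> calc E (bcalc g) g.
Proof.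
move=> /(calc_exists pE)[G cG].
rewrite (_ : bcalc g = G)//; apply/funext => x; rewrite /bcalc.
case: xgetP => [_ _ [H cH <-]|/(_ (G x))[]]; last by exists G.
exact: calc_uniq cH cG.
Qed.

Definition sublevel n : set T := [set t | `|f t| <= n%:R].
Definition trunc n t : R := f t * \1_(sublevel n) t.
(** The bounded operator that agrees with f(H) on the spectral subspace
    |f| <= n and vanishes on its complement. *)
Definition truncop n : V -> V := bcalc (trunc n).
Local Notation Tf := (pvm_integral E (fun x => (f x)%:C)).

Lemma measurable_sublevel n : measurable (sublevel n).
Proof.
rewrite (_ : sublevel n = setT `&` f @^-1` `[- n%:R, n%:R]%classic).
  exact: mf.
by rewrite setTI; apply/seteqP; split => t; rewrite /sublevel /= in_itv/= ler_norml.
Qed.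

Lemma trunc_le n t : `|trunc n t| <= n%:R.
Proof.
rewrite /trunc normrM indicE; have [tX|_] := boolP (t \in sublevel n).
  by rewrite normr1 mulr1; move: tX; rewrite inE.
by rewrite normr0 mulr0.
Qed.

Lemma trunc_le_f n t : `|trunc n t| <= `|f t|.
Proof.
rewrite /trunc normrM indicE; case: (t \in sublevel n).
  by rewrite normr1 mulr1.
by rewrite normr0 mulr0.
Qed.

Lemma trunc_eq n t : `|f t| <= n%:R -> trunc n t = f t.
Proof. by move=> h; rewrite /trunc indicE mem_set// mulr1. Qed.

Lemma trunc_mul n m t : (n <= m)%N -> trunc m t * trunc n t = trunc n t * trunc n t.
Proof.
move=> le_nm; rewrite /trunc !indicE; have [tn|tn] := boolP (t \in sublevel n).
  rewrite mem_set ?mulr1//=; move: tn; rewrite inE /sublevel/= => /le_trans -> //.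
  by rewrite ler_nat.
by rewrite !mulr0.
Qed.

Lemma bmeas_trunc n : bmeas (trunc n).
Proof.
split; last by exists n%:R => t; exact: trunc_le.
apply: measurable_funM => //; exact: measurable_indic (measurable_sublevel n).
Qed.

Lemma calc_truncop n : calc E (truncop n) (trunc n).
Proof. exact/bcalcP/bmeas_trunc. Qed.

(** The sublevel sets of |f| cover the line, so the spectral measure of y is
    carried by their union. *)
Lemma pvm_exhaust y : (forall n, E (sublevel n) y = 0) -> y = 0.
Proof.
move=> y0; apply/rnorm0_eq0/eqP; rewrite -sqrf_eq0 -(mu_setT pE).
suff -> : mu y setT = 0%E by [].
have -> : setT = \bigcup_n sublevel n.
  apply/seteqP; split => // t _; exists (Num.truncn `|f t|).+1 => //=.
  by rewrite /sublevel/= ltW// truncnS_gt.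
have mX := measurable_sublevel.
apply/eqP; rewrite -measure_le0.
have := @measure_sigma_subadditive _ _ _ (mu y) (\bigcup_n sublevel n) sublevel mX
  (bigcupT_measurable _ mX) (@subset_refl _ _).
by rewrite eseries0// => n _ _; rewrite /= /pvm_measure y0 normr0/= expr0n.
Qed.

Lemma dom_pvm_integral_sqr psi : dom Tf psi <-> (\int[mu psi]_t (f t ^+ 2)%:E < +oo)%E.
Proof.
rewrite /= /pvm_dom /=.
by under eq_integral do rewrite /= expr0n addr0.
Qed.

Let rnorm_truncop n psi :
  (rnorm (truncop n psi) ^+ 2)%:E = (\int[mu psi]_t (trunc n t ^+ 2)%:E)%E.
Proof.
rewrite (calc_norm pE _ (calc_truncop n)) /Rintegral fineK//.
apply: integrable_fin_num => //.
exact: bmeas_integrable (bmeasM (bmeas_trunc n) (bmeas_trunc n)).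
Qed.

Let sqr_norm (a b : R) : `|a| <= `|b| -> a ^+ 2 <= b ^+ 2.
Proof.
by rewrite -(real_normK (num_real a)) -(real_normK (num_real b)) ler_pXn2r ?nnegrE.
Qed.

Let trunc_mono n m t : (n <= m)%N -> trunc n t ^+ 2 <= trunc m t ^+ 2.
Proof.
move=> le_nm; apply: sqr_norm; rewrite /trunc !indicE.
have [tn|tn] := boolP (t \in sublevel n); last by rewrite mulr0 normr0.
rewrite mem_set//; move: tn; rewrite inE /sublevel/= => /le_trans -> //.
by rewrite ler_nat.
Qed.

(** |truncop n psi|^2 is the integral of the truncated square of f, which
    increases to the integral of f^2.  This turns membership in the domain
    into a statement about bounded operators, for which linearity and the
    multiplication rule are available. *)
Lemma dom_pvm_integralP psi :
  dom Tf psi <-> exists c, forall n, rnorm (truncop n psi) <= c.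
Proof.
split=> [/dom_pvm_integral_sqr If|[c nc]].
  set I := (\int[_]_t _)%E in If.
  have I0 : (0 <= I)%E by apply: integral_ge0 => t _; rewrite lee_fin sqr_ge0.
  have If' : I \is a fin_num by rewrite ge0_fin_numE.
  exists (1 + fine I) => n.
  have : rnorm (truncop n psi) ^+ 2 <= fine I.
    rewrite -lee_fin rnorm_truncop fineK//; apply: ge0_le_integral => //.
    - by move=> t _; rewrite lee_fin sqr_ge0.
    - by apply/measurable_EFinP; have [] := bmeasM (bmeas_trunc n) (bmeas_trunc n).
    - by apply/measurable_EFinP; exact: measurable_funX.
    - by move=> t _; rewrite lee_fin sqr_norm// trunc_le_f.
  have : 0 <= fine I by rewrite fine_ge0.
  have := rnorm_ge0 (truncop n psi); nra.
apply/dom_pvm_integral_sqr.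
have mg n : measurable_fun setT (fun t : T => (trunc n t ^+ 2)%:E).
  by apply/measurable_EFinP; have [] := bmeasM (bmeas_trunc n) (bmeas_trunc n).
have := @cvg_monotone_convergence _ _ _ (mu psi) setT measurableT _ mg.
have eqf : (fun t : T => limn (fun n => (trunc n t ^+ 2)%:E)) =
    (fun t => (f t ^+ 2)%:E).
  apply/funext => t; apply/cvg_lim => //; apply: cvg_near_cst.
  exists (Num.truncn `|f t|).+1 => // n /= tn; rewrite trunc_eq//.
  by rewrite ltW// (lt_le_trans (truncnS_gt _))// ler_nat.
rewrite eqf => cv.
apply: (@le_lt_trans _ _ (c ^+ 2)%:E); last by rewrite ltry.
apply: (cvge_le _ (cv _ _)).
- apply: nearW => n; rewrite -rnorm_truncop lee_fin.
  by rewrite ler_pXn2r ?nnegrE ?rnorm_ge0// (le_trans (rnorm_ge0 _) (nc n)).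
- by move=> n t _; rewrite lee_fin sqr_ge0.
- by move=> t _ n m /trunc_mono le_nm; rewrite lee_fin.
Qed.

Lemma dom_pvm_integral_lin (a : R[i]) psi phi : dom Tf psi -> dom Tf phi ->
  dom Tf (psi + a *: phi).
Proof.
move=> /dom_pvm_integralP[c hc] /dom_pvm_integralP[d hd]; apply/dom_pvm_integralP.
exists (c + complex.Re `|a| * d) => n; have [lP _ _ _] := calcP pE (calc_truncop n).
rewrite (linD lP) (linZ lP); apply: le_trans (rnormD _ _) (lerD (hc n) _).
have a0 : `|a| = (complex.Re `|a|)%:C by rewrite RRe_real// ger0_real.
have aR : 0 <= complex.Re `|a| by rewrite -lecR -a0; exact: normr_ge0.
apply: (@le_trans _ _ (complex.Re `|a| * rnorm (truncop n phi))); last first.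
  by rewrite ler_wpM2l.
by rewrite -lecR -norm_rnorm normrZ norm_rnorm {1}a0 -rmorphM.
Qed.

(** For n <= m the supports of trunc n and of trunc m - trunc n are disjoint,
    so |truncop n psi - truncop m psi|^2 is the increment of a bounded
    monotone sequence. *)
Lemma truncop_is_cvg psi : dom Tf psi ->
  exists chi : V, (fun n => truncop n psi) @ \oo --> chi.
Proof.
move=> /dom_pvm_integralP[c hc]; apply: cauchyV => e e0.
pose a n := rnorm (truncop n psi) ^+ 2.
have aE n : a n = \int[mu psi]_t (trunc n t ^+ 2) 
  by rewrite /a; have := calc_norm pE psi (calc_truncop n).
have b2 n : bmeas (fun t => trunc n t ^+ 2) := bmeasM (bmeas_trunc n) (bmeas_trunc n).
have am : {homo a : n m / (n <= m)%N >-> n <= m}.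
  by move=> n m le_nm; rewrite !aE; apply: le_int_bmeas => // t; exact: trunc_mono.
have : cvg (a @ \oo).
  apply: nondecreasing_is_cvgn => //; exists (c ^+ 2) => _ [n _ <-].
  by rewrite ler_pXn2r ?nnegrE ?rnorm_ge0// (le_trans (rnorm_ge0 _) (hc n)).
move=> /cvg_ex[l /cvgrPdist_le /(_ (e ^+ 2 / 2))].
rewrite divr_gt0 ?exprn_gt0// => /(_ isT)[N _ aN].
(* The cross term is 2 trunc n * trunc m = 2 (trunc n)^2. *)
have dist n m : (n <= m)%N -> rnorm (truncop n psi - truncop m psi) ^+ 2 = a m - a n.
  move=> le_nm.
  rewrite (calc_norm pE psi (calc_B (calc_truncop n) (calc_truncop m))) !aE -int_bmeasB//.
  apply: eq_Rintegral => t _.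
  have := trunc_mul t le_nm; rewrite !expr2 => h; nra.
exists N => n m Nn Nm; wlog le_nm : n m Nn Nm / (n <= m)%N.
  move=> W; have [|mn] := leqP n m; first exact: W.
  by rewrite -rnormN opprB W// ltnW.
rewrite -(@ler_pXn2r _ 2)// ?nnegrE ?rnorm_ge0 ?(ltW e0)// dist//.
have := aN n Nn; have := aN m Nm; rewrite !ler_norml => /andP[? ?] /andP[? ?].
lra.
Qed.

Lemma integral_cvg psi : dom Tf psi ->
  (fun n => \int[mu psi]_t trunc n t) @ \oo --> \int[mu psi]_t f t.
Proof.
move=> /dom_pvm_integral_sqr If.
have mtrunc n : measurable_fun setT (EFin \o (trunc n : T -> R)).
  by apply/measurable_EFinP; have [] := bmeas_trunc n.
have intg : (mu psi).-integrable setT (fun t : T => (1 + f t ^+ 2)%:E).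
  have i1 := bmeas_integrable pE psi (bmeas_cst (1 : R)).
  have i2 : (mu psi).-integrable setT (fun t : T => (f t ^+ 2)%:E).
    apply/integrableP; split.
      by apply/measurable_EFinP; exact: measurable_funX.
    by under eq_integral do rewrite /= ger0_norm ?sqr_ge0//.
  by have := integrableD measurableT i1 i2; apply: eq_integrable.
have cvf (t : T) : (EFin \o trunc^~ t) n @[n --> \oo] --> (f t)%:E.
  apply: cvg_near_cst; exists (Num.truncn `|f t|).+1 => // n /= tn.
  by rewrite trunc_eq// ltW// (lt_le_trans (truncnS_gt _))// ler_nat.
have fg t : `|f t| <= 1 + f t ^+ 2.
  rewrite -(real_normK (num_real (f t))); have := normr_ge0 (f t); nra.
have cv : ((fun n => \int[mu psi]_t (trunc n t)%:E) @ \oo -->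
    \int[mu psi]_t (f t)%:E)%E.
  apply: (dominated_cvg measurableT mtrunc (fun t _ => cvf t) _ intg) => //.
  by move=> n t _ /=; rewrite lee_fin (le_trans (trunc_le_f n t)).
have intf : (mu psi).-integrable setT (EFin \o (f : T -> R)).
  apply: (le_integrable measurableT _ _ intg); first exact/measurable_EFinP.
  move=> t _ /=; rewrite lee_fin (le_trans (fg t))//.
  by rewrite ler_norm.
apply: fine_cvg; rewrite fineK; last exact: integrable_fin_num.
exact: cv.
Qed.

End Unbounded.

(** * The operator of an unbounded real function *)

Section Operator.
Context (R : realType) (V : hilbertType R).
Variables (E : set R -> V -> V) (pE : is_pvm E).
Local Notation T := (measurableTypeR R).
Local Notation mu := (pvm_mu pE).
Variables (f : R -> R) (mf : measurable_fun setT (f : T -> R)).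
Implicit Types (psi phi chi : V).
Local Notation Tf := (pvm_integral E (fun x => (f x)%:C)).
Local Notation sublevel := (sublevel f).
Local Notation trunc := (trunc f).
Local Notation truncop := (truncop E f).
Local Notation calc_truncop := (calc_truncop pE mf).

Lemma trunc_indic_le n m t : `|trunc m t * \1_(sublevel n) t| <= n%:R.
Proof.
rewrite normrM indicE; have [tn|_] := boolP (t \in sublevel n).
  rewrite normr1 mulr1 (le_trans (trunc_le_f f m t))//.
  by move: tn; rewrite inE.
by rewrite normr0 mulr0.
Qed.

Lemma dom_sublevel n psi : dom Tf (E (sublevel n) psi).
Proof.
apply/(dom_pvm_integralP pE mf); exists (n%:R * rnorm psi) => m.
have cM := calc_M pE (calc_truncop m) (calc_E E (measurable_sublevel mf n)).
by apply: (calc_bound pE psi cM) => t; exact: trunc_indic_le.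
Qed.

Lemma dom_pvm_integral_dense y : (forall phi, dom Tf phi -> rdot y phi = 0) -> y = 0.
Proof.
move=> y0; apply: (pvm_exhaust pE mf) => n.
have mX := measurable_sublevel mf n.
apply/rnorm0_eq0/eqP; rewrite -sqrf_eq0 -(pvm_diag pE _ mX) rdotC y0//.
exact: dom_sublevel.
Qed.

Lemma integralC_real psi (g : R -> R) :
  integralC (pvm_measure E psi) (fun x => (g x)%:C) =
  (\int[mu psi]_t g t)%:C.
Proof.
rewrite /integralC /=; congr (_ +i* _).
by rewrite integral0_eq.
Qed.

Lemma truncop_diag psi chi : dom Tf psi ->
  (fun n => truncop n psi) @ \oo --> chi -> \int[mu psi]_t f t = rdot chi psi.
Proof.
move=> dpsi cv; apply: (cvgR_unique (integral_cvg (pE := pE) mf dpsi)).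
have -> : (fun n => \int[mu psi]_t trunc n t) = fun n => rdot (truncop n psi) psi.
  by apply/funext => n; have [_ _ _ ->] := calcP pE (calc_truncop n).
exact: cvg_rdot cv (cvgV_cst psi).
Qed.

Lemma truncop_sym psi phi u v :
  (fun n => truncop n psi) @ \oo --> u -> (fun n => truncop n phi) @ \oo --> v ->
  rdot u phi = rdot psi v.
Proof.
move=> cu cv; apply: (cvgR_unique (cvg_rdot cu (cvgV_cst phi))).
have -> : (fun n => rdot (truncop n psi) phi) = fun n => rdot psi (truncop n phi).
  by apply/funext => n; have [_ sP _ _] := calcP pE (calc_truncop n); exact: sP.
exact: cvg_rdot (cvgV_cst psi) cv.
Qed.

Lemma truncop_lin (a : R[i]) psi phi u v :
  (fun n => truncop n psi) @ \oo --> u -> (fun n => truncop n phi) @ \oo --> v ->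
  (fun n => truncop n (psi + a *: phi)) @ \oo --> u + a *: v.
Proof.
move=> cu cv.
have -> : (fun n => truncop n (psi + a *: phi)) =
    fun n => truncop n psi + a *: truncop n phi.
  apply/funext => n; have [lP _ _ _] := calcP pE (calc_truncop n).
  by rewrite (linD lP) (linZ lP).
exact: cvgVD cu (cvgVZ a cv).
Qed.

Lemma truncop_pvm_form psi phi u : dom Tf psi -> dom Tf phi ->
  (fun n => truncop n psi) @ \oo --> u ->
  dotp u phi = pvm_form E (fun x => (f x)%:C) psi phi.
Proof.
move=> dpsi dphi cu; have [v cv] := truncop_is_cvg pE mf dphi.
rewrite -(@polarization _ _ u v psi phi).
- rewrite /pvm_form; congr (_ * _); apply: eq_bigr => k _; congr (_ * _).
  rewrite integralC_real.
  by rewrite (truncop_diag (dom_pvm_integral_lin pE mf _ dpsi dphi) (truncop_lin cu cv)).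
- exact: truncop_sym cu cv.
- apply: truncop_sym cu _.
  have c0 : (fun n => truncop n 0) @ \oo --> (0 : V).
    have -> : (fun n => truncop n 0) = (fun=> 0 : V).
      apply/funext => n; have [lP _ _ _] := calcP pE (calc_truncop n).
      exact: lin0.
    exact: cvgV_cst.
  by have := @truncop_lin 'i%C _ _ _ _ c0 cv; rewrite !add0r.
Qed.

(** The limit of the truncations represents the polarized form, and density
    of the domain makes the representing vector unique. *)
Lemma pvm_integral_cvg psi : dom Tf psi -> (fun n => truncop n psi) @ \oo --> Tf psi.
Proof.
move=> dpsi; have [u cu] := truncop_is_cvg pE mf dpsi.
suff -> : Tf psi = u by [].
rewrite /=; case: xgetP => [y _ yP|/(_ u)[]].
  apply/eqP; rewrite -subr_eq0; apply/eqP; apply: dom_pvm_integral_dense => phi dphi.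
  rewrite rdotBl /rdot yP// (truncop_pvm_form dpsi dphi cu).
  by rewrite subrr.
by move=> phi dphi; exact: truncop_pvm_form.
Qed.

Lemma pvm_integral_sym psi phi : dom Tf psi -> dom Tf phi ->
  rdot (Tf psi) phi = rdot psi (Tf phi).
Proof. by move=> /pvm_integral_cvg cu /pvm_integral_cvg cv; exact: truncop_sym cu cv. Qed.

Lemma pvm_integral_bound psi (c : R) : (forall n, rnorm (truncop n psi) <= c) ->
  dom Tf psi /\ rnorm (Tf psi) <= c.
Proof.
move=> hc; have dpsi : dom Tf psi by apply/(dom_pvm_integralP pE mf); exists c.
split=> //; rewrite -(@ler_pXn2r _ 2)// ?nnegrE ?rnorm_ge0 ?(le_trans (rnorm_ge0 _) (hc 0))//.
apply: (cvgr_to_le (cvg_rnorm_sqr (pvm_integral_cvg dpsi))).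
by apply: nearW => n; rewrite ler_pXn2r ?nnegrE ?rnorm_ge0 ?(le_trans (rnorm_ge0 _) (hc 0)).
Qed.

(** Testing the hypothesis with phi = truncop n psi gives
    <f(H) phi, psi> = |phi|^2, since f and trunc n agree where trunc n does
    not vanish.  Together with [pvm_integral_bound] this is the inclusion of
    the domain of the adjoint in the domain of f(H). *)
Lemma truncop_adjoint psi (c : R) : 0 <= c ->
  (forall phi, dom Tf phi -> rdot (Tf phi) psi <= c * rnorm phi) ->
  forall n, rnorm (truncop n psi) <= c.
Proof.
move=> c0 hc n.
set phi := truncop n psi.
have [_ sP _ _] := calcP pE (calc_truncop n).
have cc m := calc_M pE (calc_truncop m) (calc_truncop n).
have dphi : dom Tf phi.
  apply/(dom_pvm_integralP pE mf); exists (n%:R * rnorm phi) => m.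
  (* phi lives where |f| <= n, so every truncation is at most n on it. *)
  have := calc_le pE psi (cc m) (calc_M pE (calc_Z n%:R (calc_id pE)) (calc_truncop n)).
  rewrite /= rnormZ ger0_norm//; apply => // t.
  rewrite mulr1 [leLHS]normrM [leRHS]normrM [`|n%:R|]ger0_norm//.
    have [tn|tn] := boolP (t \in sublevel n); last first.
    have -> : trunc n t = 0 by rewrite /trunc indicE (negPf tn) mulr0.
    by rewrite normr0 !mulr0.
  rewrite ler_wpM2r// (le_trans (trunc_le_f f m t))//.
  by move: tn; rewrite inE.
have Tphi : Tf phi = truncop n phi.
  apply: (cvgV_unique (pvm_integral_cvg dphi)).
  apply: (@cvgV_near_eq _ _ _ _ _ (fun=> truncop n phi)); last exact: cvgV_cst.
  exists n => // m /= le_nm; apply: (calc_uniq (H := truncop m \o truncop n) pE psi (cc n)).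
  apply: calc_eq (cc m) => //.
  by apply/funext => t; rewrite trunc_mul.
have := hc phi dphi; rewrite Tphi sP rdotxx -/phi => h.
by apply: le_of_sqr_le_mul h; rewrite ?rnorm_ge0.
Qed.

End Operator.

(** * The unitary group preserves inner products *)

Section Unitary.
Context (R : realType) (V : hilbertType R).
Variables (E : set R -> V -> V) (pE : is_pvm E).
Local Notation T := (measurableTypeR R).
Local Notation mu := (pvm_mu pE).
Variables (s : R).

Let cosf (x : R) : R := cos (s * x).
Let sinf (x : R) : R := sin (s * x).
Local Notation U := (pvm_integral E (fun x => cos (s * x) +i* sin (s * x))).

Let bmeas_cos : bmeas cosf.
Proof.
split.
  apply: continuous_measurable_fun => x; apply: continuous_comp.
    exact: mulrl_continuous.
  exact: continuous_cos.
by exists 1 => t; rewrite /cosf ler_norml cos_geN1 cos_le1.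
Qed.

Let bmeas_sin : bmeas sinf.
Proof.
split.
  apply: continuous_measurable_fun => x; apply: continuous_comp.
    exact: mulrl_continuous.
  exact: continuous_sin.
by exists 1 => t; rewrite /sinf ler_norml sin_geN1 sin_le1.
Qed.

Lemma calc_polarization (G : V -> V) g psi phi : calc E G g ->
  4%:R^-1 * (\sum_(k < 4) 'i%C ^+ k *
    (\int[mu (psi + 'i%C ^+ k *: phi)]_t g t)%:C) = dotp (G psi) phi.
Proof.
move=> cG; have [lG sG _ GG] := calcP pE cG.
rewrite -(@polarization _ _ (G psi) (G phi) psi phi).
- congr (_ * _); apply: eq_bigr => k _; congr (_ * _).
  by rewrite -GG (linD lG) (linZ lG).
- exact: sG.
- by rewrite sG (linZ lG).
Qed.

Lemma dom_unitary psi : dom U psi.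
Proof.
rewrite /= /pvm_dom /=.
under eq_integral do rewrite /= cos2Dsin2.
have /= -> := integral_cst (mu psi) measurableT 1.
by rewrite mul1e; exact: ltry.
Qed.

Lemma unitary_form psi phi (C S : V -> V) : calc E C cosf -> calc E S sinf ->
  dotp (C psi + 'i%C *: S psi) phi =
  pvm_form E (fun x => cos (s * x) +i* sin (s * x)) psi phi.
Proof.
move=> cC cS; rewrite (linearDl dotp) (linearZl_LR dotp) /=.
rewrite -(calc_polarization psi phi cC) -(calc_polarization psi phi cS).
rewrite mulrCA -mulrDr /pvm_form mulr_sumr -big_split/=; congr (_ * _).
apply: eq_bigr => k _; rewrite mulrCA -mulrDr; congr (_ * _).
rewrite /integralC /=.
by apply/eqP; rewrite eq_complex /= !(mul0r, mul1r, subr0, sub0r, addr0, add0r, oppr0) !eqxx.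
Qed.

(** U = C + i S with commuting symmetric C and S and C^2 + S^2 = 1: the cross
    terms of <U psi, U phi> cancel. *)
Lemma unitary_rdot psi phi : rdot (U psi) (U phi) = rdot psi phi.
Proof.
have [C cC] := calc_exists pE bmeas_cos; have [S cS] := calc_exists pE bmeas_sin.
have UE x : U x = C x + 'i%C *: S x.
  rewrite /=; case: xgetP => [y _ yP|/(_ (C x + 'i%C *: S x))[]].
    apply: rdot_inj => z; rewrite /rdot yP ?(unitary_form _ _ cC cS)//.
    exact: dom_unitary.
  by move=> z _; exact: unitary_form.
have [lC sC _ _] := calcP pE cC; have [lS sS _ _] := calcP pE cS.
have CS x : C (S x) = S (C x).
  apply: (calc_uniq (H := S \o C) pE x (calc_M pE cC cS)).
  apply: calc_eq (calc_M pE cS cC) => //.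
  by apply/funext => t; rewrite mulrC.
have CCSS x : C (C x) + S (S x) = x.
  apply: (calc_uniq (H := id) pE x (calc_D (calc_M pE cC cC) (calc_M pE cS cS))).
  apply: calc_eq (calc_id pE) => //.
  by apply/funext => t; rewrite -!expr2 cos2Dsin2.
rewrite !UE !rdotDl !rdotDr !rdot_i.
rewrite !scalerA -expr2 sqr_i scaleN1r rdotNr opprK.
rewrite !sC !sS (linZ lC) (linZ lS) CS [X in X + _]addrC.
rewrite addrACA subrr add0r -rdotDr.
by rewrite CCSS.
Qed.

End Unitary.

(** * The projection onto the absolutely continuous subspace *)

Section AbsolutelyContinuous.
Context (R : realType) (V : hilbertType R) (H : operator V).
Local Notation T := (measurableTypeR R).
Local Notation E := (spectral_measure H).
Hypothesis pE : is_pvm E.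
Local Notation ac := (ac_subspace H).
Local Notation P := (ac_proj H).
Local Notation leb := (@lebesgue_measure R).
Implicit Types (X Y N : set T) (psi phi eta : V).

Lemma acP psi :
  ac psi <-> forall X, measurable X -> leb X = 0%E -> E X psi = 0.
Proof.
split=> [acpsi X mX X0|h N N0 A mA AN].
  have nX : leb.-null_set X.
    move=> A mA AX; apply/eqP; rewrite -measure_le0 -X0.
    by apply: le_measure; rewrite ?inE.
  have := acpsi X nX X mX (@subset_refl _ _).
  rewrite /pvm_measure => /eqP; rewrite eqe sqrf_eq0 => /eqP.
  exact: rnorm0_eq0.
by rewrite /pvm_measure h ?N0// normr0 /= expr0n.
Qed.

Lemma ac_lin (a : R[i]) psi phi : ac psi -> ac phi -> ac (psi + a *: phi).
Proof.
move=> /acP h1 /acP h2; apply/acP => X mX X0; have lX := pvm_lin pE mX.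
by rewrite (linD lX) (linZ lX) h1// h2// scaler0 addr0.
Qed.

Lemma ac_B psi phi : ac psi -> ac phi -> ac (psi - phi).
Proof. by move=> h1 h2; rewrite -scaleN1r; exact: ac_lin. Qed.

Lemma ac_D psi phi : ac psi -> ac phi -> ac (psi + phi).
Proof. by move=> h1 h2; rewrite -[phi]scale1r; exact: ac_lin. Qed.

Lemma ac_i psi : ac psi -> ac ('i%C *: psi).
Proof.
move=> h; rewrite -[_ *: _]add0r; apply: ac_lin => //.
by rewrite -(subrr psi); exact: ac_B.
Qed.

Lemma ac_pvm Y psi : measurable Y -> ac psi -> ac (E Y psi).
Proof.
move=> mY /acP h; apply/acP => X mX X0.
by rewrite pvm_comp// setIC -pvm_comp// h// (lin0 (pvm_lin pE mY)).
Qed.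

(** Each vector has its own Lebesgue-null set N that maximizes |E(N)psi|; a
    further null set cannot carry any mass of psi - E(N)psi, and E(N)psi is
    orthogonal to all absolutely continuous vectors.  So the orthogonal
    projection exists, with value psi - E(N)psi at psi. *)
Lemma ac_projection_exists psi :
  exists N, [/\ measurable N, leb N = 0%E & ac (psi - E N psi)].
Proof.
pose S := [set r : R | exists X, [/\ measurable X, leb X = 0%E & rnorm (E X psi) ^+ 2 = r]].
have S0 : S (rnorm (E set0 psi) ^+ 2) by exists set0; split => //; rewrite measure0.
have Sub : ubound S (rnorm psi ^+ 2).
  by move=> _ [X [mX _ <-]]; rewrite ler_pXn2r ?nnegrE ?rnorm_ge0// pvm_contract.
have supS : has_sup S by split; [eexists; exact: S0|eexists; exact: Sub].
have /choice[X Xn] n : exists X, [/\ measurable X, leb X = 0%E &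
    sup S - n.+1%:R^-1 < rnorm (E X psi) ^+ 2].
  have [|_ [X [mX X0 <-]] h] := @sup_adherent _ S n.+1%:R^-1 _ supS.
    by rewrite invr_gt0.
  by exists X.
have mX n : measurable (X n) by have [] := Xn n.
pose N : set T := \bigcup_n X n.
have mN : measurable N by exact: bigcupT_measurable.
have N0 : leb N = 0%E.
  apply/eqP; rewrite -measure_le0.
  have := @measure_sigma_subadditive _ _ _ leb N X mX mN (@subset_refl _ _).
  by rewrite eseries0// => n _ _; have [] := Xn n.
have supN : sup S <= rnorm (E N psi) ^+ 2.
  apply/ler_addgt0Pr => e e0; rewrite -lerBlDr.
  pose n := Num.truncn e^-1; have [_ _ h] := Xn n.
  have ne : n.+1%:R^-1 <= e.
    rewrite -[e]invrK lef_pV2 ?posrE ?invr_gt0//.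
    by rewrite ltW// truncnS_gt.
  apply: (@le_trans _ _ (rnorm (E (X n) psi) ^+ 2)).
    by rewrite (le_trans _ (ltW h))// lerB.
  have -> : E (X n) psi = E (X n) (E N psi).
    by rewrite pvm_comp// setIidl//; exact: bigcup_sup.
  by rewrite ler_pXn2r ?nnegrE ?rnorm_ge0// pvm_contract.
exists N; split=> //; apply/acP => Y mY Y0.
have mD : measurable (Y `\` N) by exact: measurableD.
have mI : measurable (Y `&` N) by exact: measurableI.
have mU : measurable (Y `|` N) by exact: measurableU.
have YN : E Y psi = E (Y `&` N) psi + E (Y `\` N) psi.
  rewrite -pvm_add ?setUIDK//.
  by rewrite setDE setIACA setICr setI0.
rewrite (linB (pvm_lin pE mY)) pvm_comp// YN addrAC subrr add0r.
apply/rnorm0_eq0/eqP; rewrite -sqrf_eq0 -(pvm_diag pE)//.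
have UN : E (Y `|` N) psi = E (Y `\` N) psi + E N psi.
  rewrite -pvm_add//; last by rewrite setDE -setIA setICl setI0.
  by rewrite setDE setUIl setvU setIT.
have U0 : leb (Y `|` N) = 0%E.
  apply/eqP; rewrite -measure_le0.
  have e0 : (leb Y + leb N = 0)%E by rewrite Y0 N0 adde0.
  by rewrite -e0; exact: measureU2.
have : rnorm (E (Y `|` N) psi) ^+ 2 <= sup S.
  by apply: ub_le_sup; [eexists; exact: Sub|exists (Y `|` N)].
rewrite -(pvm_diag pE)// UN rdotDl [X in _ + X](pvm_diag pE)// => le1.
rewrite eq_le (pvm_diag pE)// sqr_ge0 andbT -(pvm_diag pE)//; lra.
Qed.

Lemma ac_projP psi : ac (P psi) /\
  forall eta, ac eta -> rdot (psi - P psi) eta = 0.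
Proof.
have [N [mN N0 acN]] := ac_projection_exists psi.
rewrite /ac_proj /orthogonal_projection; case: xgetP => [y _ [acy yP]|].
  by split=> // eta aceta; rewrite /rdot yP.
move=> /(_ (psi - E N psi))[]; split=> // eta aceta.
have h phi : ac phi -> rdot (E N psi) phi = 0.
  by move=> /acP h; rewrite (pvm_sym pE mN) h// rdot0r.
by rewrite subKr dotp_decomp !h//; exact: ac_i.
Qed.

Lemma ac_proj_ac psi : ac (P psi). Proof. by have [] := ac_projP psi. Qed.

Lemma ac_proj_ortho psi eta : ac eta -> rdot (psi - P psi) eta = 0.
Proof. by have [_] := ac_projP psi; apply. Qed.

Lemma ac_projD psi phi : P (psi + phi) = P psi + P phi.
Proof.
apply/eqP; rewrite -subr_eq0; apply/eqP/rnorm0_eq0/eqP.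
rewrite -sqrf_eq0 -rdotxx.
set d := P (psi + phi) - (P psi + P phi).
have acd : ac d by apply: ac_B; [|apply: ac_D]; exact: ac_proj_ac.
have -> : rdot d d = rdot (psi - P psi) d + rdot (phi - P phi) d -
    rdot (psi + phi - P (psi + phi)) d.
  by rewrite /d !rdotBl !rdotDl; ring.
by rewrite !ac_proj_ortho// addr0 subr0.
Qed.

Definition singproj psi := psi - P psi.

Lemma singprojD psi phi : singproj (psi + phi) = singproj psi + singproj phi.
Proof. by rewrite /singproj ac_projD opprD addrACA. Qed.

Lemma ac_proj_rdot psi phi : rdot (P psi) phi = rdot (P psi) (P phi).
Proof.
apply/eqP; rewrite -subr_eq0 -rdotBr rdotC ac_proj_ortho//.
exact: ac_proj_ac.
Qed.

Lemma ac_proj_norm psi :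
  rnorm psi ^+ 2 = rnorm (P psi) ^+ 2 + rnorm (singproj psi) ^+ 2.
Proof.
have h : rdot (singproj psi) (P psi) = 0 by exact/ac_proj_ortho/ac_proj_ac.
have -> : rnorm psi = rnorm (singproj psi + P psi) by rewrite subrK.
move: h; move: (singproj psi) (P psi) => s p h.
by rewrite -!rdotxx rdotDl !rdotDr (rdotC p s) h addr0 add0r addrC.
Qed.

Lemma ac_proj_le psi : rnorm (P psi) <= rnorm psi.
Proof.
rewrite -(@ler_pXn2r _ 2)// ?nnegrE ?rnorm_ge0// (ac_proj_norm psi).
by rewrite lerDl sqr_ge0.
Qed.

Lemma singproj_le psi : rnorm (singproj psi) <= rnorm psi.
Proof.
rewrite -(@ler_pXn2r _ 2)// ?nnegrE ?rnorm_ge0// (ac_proj_norm psi).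
by rewrite lerDr sqr_ge0.
Qed.

End AbsolutelyContinuous.

(** * Boundedness of f(H) off the absolutely continuous subspace *)

Section SingularPart.
Context (R : realType) (V : hilbertType R) (H : operator V).
Local Notation T := (measurableTypeR R).
Local Notation E := (spectral_measure H).
Hypothesis sE : is_spectral_measure H E.
Let pE : is_pvm E := sE.1.
Hypothesis bH : bounded_non_ac H.
Local Notation ac := (ac_subspace H).
Local Notation P := (ac_proj H).
Implicit Types (psi phi eta : V).

Definition ac_ortho psi := forall eta, ac eta -> rdot psi eta = 0.

Lemma ac_ortho_pvm (X : set T) psi : measurable X -> ac_ortho psi ->
  ac_ortho (E X psi).
Proof.
by move=> mX h eta aceta; rewrite (pvm_sym pE mX) h//; exact: ac_pvm.
Qed.

Lemma singproj_ortho psi : ac_ortho (singproj H psi).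
Proof. by move=> eta; exact: ac_proj_ortho. Qed.

Let midR : measurable_fun setT ((fun x => x) : T -> R).
Proof. exact: measurable_id. Qed.

(** For psi orthogonal to the absolutely continuous subspace,
    <H phi, psi> = <(1 - P)H phi, psi>, which is O(|phi|); the adjoint
    argument then applies to H itself. *)
Lemma ac_ortho_id_bounded : exists2 c : R, 0 <= c & forall psi, ac_ortho psi ->
  forall n, rnorm (truncop E (fun x => x) n psi) <= c * rnorm psi.
Proof.
have [c hc] := bH; exists `|c| => // psi opsi; apply: (truncop_adjoint pE midR).
  by rewrite mulr_ge0// rnorm_ge0.
move=> phi dphi; have [domE HE] := sE.2.
have dHphi : dom H phi by rewrite domE.
rewrite -HE//.
have -> : rdot (H phi) psi = rdot (singproj H (H phi)) psi.
  rewrite /singproj rdotBl (rdotC (P _)) opsi ?subr0//; exact: ac_proj_ac.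
apply: le_trans (rdot_le _ _) _; rewrite mulrAC ler_wpM2r ?rnorm_ge0//.
have := hc phi (conj dHphi I); rewrite !norm_rnorm -rmorphM lecR => /le_trans; apply.
by rewrite ler_wpM2r ?rnorm_ge0// ler_norm.
Qed.

(** On the spectral subspace c + 1 < |x| <= n the operator H multiplies norms
    by at least c + 1, while it multiplies them by at most c on the
    orthogonal complement of the absolutely continuous subspace. *)
Lemma ac_ortho_compact_support : exists2 c : R, 0 <= c & forall psi, ac_ortho psi ->
  E [set x | c < `|x|] psi = 0.
Proof.
have [c c0 hc] := ac_ortho_id_bounded; exists (c + 1); first by rewrite addr_ge0.
move=> psi opsi; set Y : set T := [set x | _].
have mY : measurable Y.
  rewrite (_ : Y = setT `&` (fun x : R => `|x|) @^-1` `]c + 1, +oo[%classic).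
    by apply: (continuous_measurable_fun (@norm_continuous _ _)).
  by rewrite setTI; apply/seteqP; split => t; rewrite /Y/= in_itv/= andbT.
apply: (pvm_exhaust pE midR) => n.
have mX := measurable_sublevel midR n.
set X := sublevel _ n in mX *.
have mZ : measurable (X `&` Y) by exact: measurableI.
rewrite pvm_comp//; set Z := X `&` Y in mZ *.
have oZ := ac_ortho_pvm mZ opsi.
have cT := calc_truncop pE midR n.
have h1 := hc _ oZ n.
have h2 := calc_le pE psi (calc_M pE (calc_Z (c + 1) (calc_id pE)) (calc_E E mZ))
  (calc_M pE cT (calc_E E mZ)).
apply/rnorm0_eq0/le_anti; rewrite rnorm_ge0 andbT.
have : rnorm ((c + 1)%:C *: E Z psi) <= rnorm (truncop E (fun x => x) n (E Z psi)).
  apply: h2 => t; rewrite mulr1 indicE; have [tZ|_] := boolP (t \in Z).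
    move: tZ; rewrite inE => -[Xt Yt].
    rewrite !mulr1 trunc_eq// ger0_norm ?addr_ge0//; exact: ltW.
  by rewrite !mulr0.
rewrite rnormZ ger0_norm ?addr_ge0// mulrDl mul1r => h3; lra.
Qed.

Variables (f : R -> R) (cf : continuous f).
Local Notation Tf := (real_fun_calc f H).

Lemma continuous_measurableT : measurable_fun setT (f : T -> R).
Proof. exact: continuous_measurable_fun. Qed.
Let mf := continuous_measurableT.

Lemma ac_ortho_truncop_bounded : exists2 M : R, 0 <= M & forall psi, ac_ortho psi ->
  forall n, rnorm (truncop E f n psi) <= M * rnorm psi.
Proof.
have [c c0 hc] := ac_ortho_compact_support.
have [||d _ fd] := @EVT_max R (fun x => `|f x|) (- c) c.
- by rewrite ge0_cp.
- apply: continuous_subspaceT => x.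
  by apply: continuous_comp; [exact: cf|exact: norm_continuous].
exists `|f d| => // psi opsi n.
set Y : set T := [set x | c < `|x|] in hc.
have mY : measurable Y.
  rewrite (_ : Y = setT `&` (fun x : R => `|x|) @^-1` `]c, +oo[%classic).
    by apply: (continuous_measurable_fun (@norm_continuous _ _)).
  by rewrite setTI; apply/seteqP; split => t; rewrite /Y/= in_itv/= andbT.
have mYc : measurable (~` Y) by exact: measurableC.
have psiE : psi = E (~` Y) psi.
  rewrite -[LHS](_ : E setT psi = psi); last by rewrite (pvmT pE).
  by rewrite -(setvU Y) pvm_add// ?setICl// hc// addr0.
rewrite [in X in X <= _]psiE.
apply: (calc_bound pE psi (calc_M pE (calc_truncop pE mf n) (calc_E E mYc))).
move=> t; rewrite normrM indicE; have [tY|_] := boolP (t \in ~` Y).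
  move: tY; rewrite inE normr1 mulr1 /Y /= => /negP; rewrite -leNgt => tc.
  by apply: le_trans (trunc_le_f _ _ _) (fd _ _); rewrite in_itv/= -ler_norml.
by rewrite normr0 mulr0.
Qed.

(** With chi = (1 - P)f(H)phi, symmetry gives
    |chi|^2 = <f(H)phi, chi> = <phi, f(H)chi>, and f(H) is bounded at chi. *)
Lemma singproj_fun_calc_bounded : exists2 M : R, 0 <= M & forall phi, dom Tf phi ->
  rnorm (singproj H (Tf phi)) <= M * rnorm phi.
Proof.
have [M M0 hM] := ac_ortho_truncop_bounded; exists M => // phi dphi.
set chi := singproj H (Tf phi).
have ochi : ac_ortho chi by exact: singproj_ortho.
have [dchi Tchi] := pvm_integral_bound pE mf (hM _ ochi).
apply: le_of_sqr_le_mul; rewrite ?rnorm_ge0// ?mulr_ge0// ?rnorm_ge0//.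
have -> : rnorm chi ^+ 2 = rdot (Tf phi) chi.
  rewrite -rdotxx {1}/chi /singproj rdotBl (rdotC (P _)) ochi ?subr0//.
  exact: ac_proj_ac.
rewrite (pvm_integral_sym pE mf dphi dchi); apply: le_trans (rdot_le _ _) _.
by rewrite mulrC mulrAC ler_wpM2r ?rnorm_ge0.
Qed.

End SingularPart.

(** * Wave operators and the theorem *)

Section WaveOperators.
Context (R : realType) (V : hilbertType R).
Implicit Types (H A : operator V) (psi phi chi : V).

(** Without a spectral measure the chosen family E is identically 0, so every
    vector lies in the domain of f(H) and is sent to 0. *)
Lemma no_spectral_measure_trivial (f : R -> R) H A :
  ~ is_spectral_measure H (spectral_measure H) ->
  inv_bounded A (real_fun_calc f H) -> forall psi, psi = 0.
Proof.
move=> nE [inj _ _] psi.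
have E0 : spectral_measure H = (fun _ _ => 0).
  rewrite /spectral_measure; case: xgetP => // E0 eE0 sE0; exfalso; apply: nE.
  by rewrite /spectral_measure -eE0.
have mu0 z : pvm_measure (spectral_measure H) z = mzero.
  by apply/funext => X; rewrite /pvm_measure E0 normr0 expr0n.
have form0 x y : pvm_form (spectral_measure H) (fun x => (f x)%:C) x y = 0.
  rewrite /pvm_form big1 ?mulr0// => k _.
  by rewrite /integralC mu0 !integral_measure_zero mulr0.
have domT x : dom (real_fun_calc f H) x.
  by rewrite /= /pvm_dom /= mu0 integral_measure_zero ltry.
have T0 x : real_fun_calc f H x = 0.
  rewrite /=; case: xgetP => [y _ yP|//].
  by apply: rdot_inj => z; rewrite /rdot yP ?form0 ?(linear0l dotp)//; exact: domT.
by apply: inj; rewrite ?inE ?T0.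
Qed.

Lemma time_limit_proper (s : bool) : ProperFilter (@time_limit R s).
Proof. by case: s; exact: _. Qed.

Lemma wave_op_rdot (s : bool) H0 H1 :
  is_pvm (spectral_measure H0) -> is_pvm (spectral_measure H1) ->
  wave_op_exists s H1 H0 ->
  forall psi phi, rdot (wave_op s H1 H0 psi) (wave_op s H1 H0 phi) =
    rdot (ac_proj H0 psi) (ac_proj H0 phi).
Proof.
move=> pE0 pE1 ex psi phi; have FF := time_limit_proper s.
have c x : wave_path H1 H0 x t @[t --> time_limit s] --> wave_op s H1 H0 x.
  exact: ex.
apply: (cvgR_unique (cvg_rdot (c psi) (c phi))).
have -> : (fun t => rdot (wave_path H1 H0 psi t) (wave_path H1 H0 phi t)) =
    (fun=> rdot (ac_proj H0 psi) (ac_proj H0 phi)).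
  by apply/funext => t; rewrite /wave_path !unitary_rdot.
exact: cvg_cst.
Qed.

Lemma inv_bounded_le A T : inv_bounded A T -> exists2 k : R, 0 <= k &
  forall eta, dom T eta -> dom A eta /\ rnorm (A eta) <= k * rnorm (T eta).
Proof.
move=> [inj sub [k hk]]; exists `|k| => // eta deta; split; first exact: sub.
have inv : op_inv T (T eta) = eta.
  rewrite /=; case: xgetP => [y _ [dy Ty]|/(_ eta)[]//].
  by apply: inj; rewrite ?inE.
have h : `|A (op_inv T (T eta))| <= k%:C * `|T eta|.
  apply: hk; split; first by exists eta.
  by rewrite inv; exact: sub.
rewrite inv !norm_rnorm -rmorphM lecR in h; apply: le_trans h _.
by rewrite ler_wpM2r ?rnorm_ge0 ?ler_norm.
Qed.

(** Adding to a form a real perturbation of size O(|psi|^2) only changes the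
    constants in its upper and lower bounds. *)
Lemma form_bounded_perturb A (C1 C2 : V -> V) (d : R) :
  (forall psi, dom A (C1 psi) <-> dom A (C2 psi)) ->
  (forall psi, dom A (C1 psi) ->
    `|rdot (A (C1 psi)) (C1 psi) - rdot (A (C2 psi)) (C2 psi)| <= d * rnorm psi ^+ 2) ->
  (forall phi, dom A phi -> dotp (A phi) phi = (rdot (A phi) phi)%:C) ->
  (form_bounded_above A C1 <-> form_bounded_above A C2) /\
  (form_bounded_below A C1 <-> form_bounded_below A C2).
Proof.
move=> dom12 close real.
have above psi c : dom A psi -> forall x : V,
    (dotp (A psi) psi <= c%:C * `|x| ^+ 2) = (rdot (A psi) psi <= c * rnorm x ^+ 2).
  by move=> dpsi x; rewrite real// norm_rnorm -rmorphXn -rmorphM lecR.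
have below psi c : dom A psi -> forall x : V,
    (c%:C * `|x| ^+ 2 <= dotp (A psi) psi) = (c * rnorm x ^+ 2 <= rdot (A psi) psi).
  by move=> dpsi x; rewrite real// norm_rnorm -rmorphXn -rmorphM lecR.
split; split=> -[c hc].
- exists (c + d) => psi d2; have d1 := (dom12 psi).2 d2.
  have := hc psi d1; have := close psi d1; rewrite !above// ler_norml mulrDl.
  move=> /andP[? ?] ?; lra.
- exists (c + d) => psi d1; have d2 := (dom12 psi).1 d1.
  have := hc psi d2; have := close psi d1; rewrite !above// ler_norml mulrDl.
  move=> /andP[? ?] ?; lra.
- exists (c - d) => psi d2; have d1 := (dom12 psi).2 d2.
  have := hc psi d1; have := close psi d1; rewrite !below// ler_norml mulrBl.
  move=> /andP[? ?] ?; lra.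
- exists (c - d) => psi d1; have d2 := (dom12 psi).1 d1.
  have := hc psi d2; have := close psi d1; rewrite !below// ler_norml mulrBl.
  move=> /andP[? ?] ?; lra.
Qed.

Lemma selfadjoint_sym A psi phi : selfadjoint A -> dom A psi -> dom A phi ->
  rdot (A psi) phi = rdot psi (A phi).
Proof.
move=> [_ _ sA] dpsi dphi; rewrite /rdot.
by have [/(_ (conj dphi erefl)) -> //] := sA phi (A phi).
Qed.

Lemma selfadjoint_domD A psi phi : selfadjoint A -> dom A psi -> dom A phi ->
  dom A (psi + phi) /\ A (psi + phi) = A psi + A phi.
Proof.
move=> [[_ lA] _ _] d1 d2; have := lA 1 _ _ d1 d2.
by rewrite !scale1r.
Qed.

Lemma selfadjoint_domZ A (a : R[i]) phi : selfadjoint A -> dom A phi ->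
  dom A (a *: phi) /\ A (a *: phi) = a *: A phi.
Proof.
move=> [[d0 lA] _ _] d1.
have [_ A00] := lA 1 _ _ d0 d0; rewrite scale1r addr0 scale1r in A00.
have A0 : A 0 = 0 by apply: (addIr (A 0)); rewrite add0r -A00.
by have := lA a _ _ d1 d0; rewrite !addr0 A0 addr0.
Qed.

(** The form of A is real, so the complex order in the statement is the order
    of real parts. *)
Lemma selfadjoint_real A psi : selfadjoint A -> dom A psi ->
  dotp (A psi) psi = (rdot (A psi) psi)%:C.
Proof.
move=> sA dpsi; have [di Ai] := selfadjoint_domZ 'i%C sA dpsi.
have h : rdot (A psi) ('i%C *: psi) = 0.
  have := selfadjoint_sym sA dpsi di.
  rewrite Ai (rdotC psi) rdot_i => h; lra.
by rewrite dotp_decomp h.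
Qed.

(** The hypotheses bound (1 - W) f(H0); since W preserves inner products up to
    P_0, the form <f(H0) phi, (W - 1) chi> reduces to that operator and to
    Q_0 f(H0), and the adjoint argument for f(H0) applies to (W - 1) chi. *)
Lemma wave_op_minus_id (f : R -> R) (cf : continuous f) (s : bool) H0 H1 :
  is_spectral_measure H0 (spectral_measure H0) ->
  is_spectral_measure H1 (spectral_measure H1) ->
  bounded_non_ac H0 -> bounded_non_ac H1 -> f_equivalent f H0 H1 ->
  exists2 K : R, 0 <= K & forall chi,
    dom (real_fun_calc f H0) (wave_op s H1 H0 chi - chi) /\
    rnorm (real_fun_calc f H0 (wave_op s H1 H0 chi - chi)) <= K * rnorm chi.
Proof.
move=> sE0 sE1 bH0 bH1 [fb _ domE [d hd]].
have [ex [c hc]] := fb s.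
have [M0 M00 hM0] := singproj_fun_calc_bounded sE0 bH0 cf.
have [M1 M10 hM1] := singproj_fun_calc_bounded sE1 bH1 cf.
have pE0 := sE0.1; have pE1 := sE1.1.
have Wdot := wave_op_rdot pE0 pE1 ex.
set W := wave_op s H1 H0 in hc Wdot *.
set T0 := real_fun_calc f H0 in domE hd hc hM0 *.
set T1 := real_fun_calc f H1 in domE hd hM1 *.
pose P0 := ac_proj H0; pose P1 := ac_proj H1.
pose Q0 := singproj H0; pose Q1 := singproj H1.
pose K := M0 + (`|d| + M1) + M0 + `|c|.
have K0 : 0 <= K by rewrite !addr_ge0.
have step phi : dom T0 phi -> rnorm (T0 phi - W (T0 phi)) <= K * rnorm phi.
  move=> dphi; have dphi1 : dom T1 phi by rewrite -domE.
  have hc' : rnorm (W (T0 phi) - P1 (P0 (T0 phi))) <= `|c| * rnorm phi.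
    have := hc phi; rewrite !norm_rnorm -rmorphM lecR => /(_ _)/le_trans; apply.
      by split.
    by rewrite ler_wpM2r ?rnorm_ge0 ?ler_norm.
  have hd' : rnorm (T0 phi - T1 phi) <= `|d| * rnorm phi.
    have := hd phi; rewrite !norm_rnorm -rmorphM lecR => /(_ _)/le_trans; apply.
      by split.
    by rewrite ler_wpM2r ?rnorm_ge0 ?ler_norm.
  have m0 := hM0 phi dphi; have m1 := hM1 phi dphi1.
  set x := T0 phi in hc' hd' m0 *; set y := T1 phi in hd' m1.
  (* 1 - W = Q0 + Q1 P0 - (W - P1 P0), and Q1 P0 = Q1 - Q1 Q0. *)
  have -> : x - W x = Q0 x + Q1 (P0 x) - (W x - P1 (P0 x)).
    have tele (a p q w : V) : a - w = (a - p) + (p - q) - (w - q).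
      by rewrite opprB -addrA (addrA (p - q)) subrK addrA subrK.
    exact: tele.
  have q1x : rnorm (Q1 x) <= (`|d| + M1) * rnorm phi.
    rewrite -[x](subrK y) /Q1 (singprojD pE1) mulrDl.
    by apply: le_trans (rnormD _ _) (lerD (le_trans (singproj_le pE1 _) hd') m1).
  have q1p : rnorm (Q1 (P0 x)) <= (`|d| + M1) * rnorm phi + M0 * rnorm phi.
    have e : Q1 x = Q1 (P0 x) + Q1 (Q0 x).
      rewrite -(singprojD pE1) (_ : P0 x + Q0 x = x)//.
      by rewrite addrC; exact: subrK.
    have -> : Q1 (P0 x) = Q1 x - Q1 (Q0 x) by rewrite e addrK.
    by apply: le_trans (rnormB _ _) (lerD q1x (le_trans (singproj_le pE1 _) m0)).
  have h1 := rnormB (Q0 x + Q1 (P0 x)) (W x - P1 (P0 x)).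
  have h2 := rnormD (Q0 x) (Q1 (P0 x)).
  rewrite /K; rewrite /Q0 in h1 h2; rewrite /Q0; lra.
exists (K + M0); first by rewrite addr_ge0.
move=> chi.
have Wle : rnorm (W chi) <= rnorm chi.
  rewrite -(@ler_pXn2r _ 2)// ?nnegrE ?rnorm_ge0// -rdotxx Wdot rdotxx.
  by rewrite ler_pXn2r ?nnegrE ?rnorm_ge0// ac_proj_le.
have mf := continuous_measurableT cf.
apply: (pvm_integral_bound pE0 mf); apply: (truncop_adjoint pE0 mf).
  by rewrite mulr_ge0 ?rnorm_ge0// addr_ge0.
move=> phi dphi; have st := step phi dphi; have m0 := hM0 phi dphi.
rewrite -/T0; set x := T0 phi in st m0 *.
have -> : rdot x (W chi - chi) = rdot (x - W x) (W chi) - rdot (Q0 x) chi.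
  by rewrite /Q0 /singproj !rdotBl rdotBr Wdot -ac_proj_rdot//; ring.
have h1 := rdot_le (x - W x) (W chi).
have h2 := rdot_norm (Q0 x) chi; rewrite ler_norml in h2; case/andP: h2 => h2 _.
have h3 : rnorm (x - W x) * rnorm (W chi) <= K * rnorm phi * rnorm chi.
  by rewrite ler_pM ?rnorm_ge0.
have h4 : rnorm (Q0 x) * rnorm chi <= M0 * rnorm phi * rnorm chi.
  by rewrite ler_wpM2r ?rnorm_ge0.
rewrite mulrAC mulrDl mulrDl; lra.
Qed.

End WaveOperators.

Theorem theorem5p1 (R : realType) (V : hilbertType R) (sepV : separable V)
    (H0 H1 : operator V) (saH0 : selfadjoint H0) (saH1 : selfadjoint H1)
    (bH0 : bounded_non_ac H0) (bH1 : bounded_non_ac H1)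
    (f : R -> R) (cf : continuous f) (feq : f_equivalent f H0 H1)
    (B : {linear V -> V}) (bB : bounded_op (op_total B))
    (A : operator V) (saA : selfadjoint A)
    (AH0 : inv_bounded A (real_fun_calc f H0))
    (AH1 : inv_bounded A (real_fun_calc f H1)) :
  forall s : bool,
    (form_bounded_above A B <-> form_bounded_above A (wave_op s H1 H0 \o B)) /\
    (form_bounded_below A B <-> form_bounded_below A (wave_op s H1 H0 \o B)).
Proof.
move=> s.
have [V0|Vn0] := pselect (forall psi : V, psi = 0).
  apply: (@form_bounded_perturb _ _ _ _ _ 0).
  - by move=> psi; rewrite (V0 (B psi)) /= (V0 (wave_op _ _ _ _)).
  - move=> psi _; rewrite (V0 (B psi)) (V0 ((wave_op _ _ _ \o _) _)).
    by rewrite subrr normr0 mul0r.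
  - by move=> phi dphi; exact: selfadjoint_real.
have [sE0|nE0] := pselect (is_spectral_measure H0 (spectral_measure H0)); last first.
  by case: Vn0; exact: no_spectral_measure_trivial nE0 AH0.
have [sE1|nE1] := pselect (is_spectral_measure H1 (spectral_measure H1)); last first.
  by case: Vn0; exact: no_spectral_measure_trivial nE1 AH1.
have [K K0 hK] := wave_op_minus_id cf s sE0 sE1 bH0 bH1 feq.
have [k k0 hk] := inv_bounded_le AH0.
have [b hb] := bB.
have pE0 := sE0.1; have pE1 := sE1.1.
have [fb _ _ _] := feq; have [ex _] := fb s.
have Wdot := wave_op_rdot pE0 pE1 ex.
set W := wave_op s H1 H0 in hK Wdot *.
pose q := k * K.
have q0 : 0 <= q by rewrite mulr_ge0.
have dA chi : dom A (W chi - chi) /\ rnorm (A (W chi - chi)) <= q * rnorm chi.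
  have [dT Tle] := hK chi; have [dAc Ale] := hk _ dT; split=> //.
  by apply: le_trans Ale _; rewrite /q -mulrA ler_wpM2l.
have Wle chi : rnorm (W chi - chi) <= 2 * rnorm chi.
  apply: le_trans (rnormB _ _) _; rewrite mulrDl mul1r lerD2r.
  rewrite -(@ler_pXn2r _ 2)// ?nnegrE ?rnorm_ge0// -rdotxx Wdot rdotxx.
  by rewrite ler_pXn2r ?nnegrE ?rnorm_ge0// ac_proj_le.
apply: (@form_bounded_perturb _ _ _ _ _ (4 * q * b ^+ 2)).
- move=> psi /=; have [d _] := dA (B psi); split=> h.
    by have [] := selfadjoint_domD saA d h; rewrite subrK.
  have [dN _] := selfadjoint_domZ (-1) saA d; have [+ _] := selfadjoint_domD saA h dN.
  by rewrite scaleN1r subKr.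
- move=> psi d1 /=; set chi := B psi in d1 *.
  have -> : W chi = chi + (W chi - chi) by rewrite addrC subrK.
  have [d dle] := dA chi.
  move: (W chi - chi) d dle (Wle chi) => delta d dle l2.
  have [_ ->] := selfadjoint_domD saA d1 d.
  rewrite rdotDl !rdotDr (selfadjoint_sym saA d1 d) (rdotC chi).
  have n1 := rdot_norm (A delta) chi.
  have n2 := rdot_norm (A delta) delta.
  have n1' : rnorm (A delta) * rnorm chi <= q * rnorm chi * rnorm chi.
    by rewrite ler_wpM2r ?rnorm_ge0.
  have n2' : rnorm (A delta) * rnorm delta <= q * rnorm chi * (2 * rnorm chi).
    by rewrite ler_pM ?rnorm_ge0.
  have bb : rnorm chi ^+ 2 <= b ^+ 2 * rnorm psi ^+ 2.
    have := hb psi I; rewrite !norm_rnorm -rmorphM lecR -exprMn => h.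
    by rewrite ler_pXn2r ?nnegrE ?rnorm_ge0 ?(le_trans (rnorm_ge0 _) h).
  have bq := ler_wpM2l q0 bb.
  move: n1 n2; rewrite !ler_norml => /andP[? ?] /andP[? ?].
  by apply/andP; split; lra.
- by move=> phi dphi; exact: selfadjoint_real.
Qed.
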